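(* Let $A:\mathbb R\to\mathbb R^{n\times n}$ be continuous with $\sup_{t}\|A(t)\|=\mu<\infty$; let $f:\mathbb R\times\mathbb R^n\times\mathbb R^n\to\mathbb R^n$ be continuous in its first argument with $f(t,0,0)=0$ and $\|f(t,y_1,w_1)-f(t,y_2,w_2)\|\le l(\|y_1-y_2\|+\|w_1-w_2\|)$; let $x'=A(t)x$ have an exponential dichotomy on $\mathbb R$ with constants $K,\sigma>0$; and let $lM\theta[1+M(1+l\theta)e^{Ml\theta}]<m$, where $M=e^{\mu\theta}$, $m=e^{-\mu\theta}$. Let $\epsilon>0$, $\alpha\in(0,\sigma)$, let the Lipschitz constant $L$ of $(g_+,g_-)$ be sufficiently small, and let $F:\mathbb R\times\mathbb R^k\to\mathbb R^{n-k}$ be the function defining the stable manifold described in the context. Then the set $$S^+=\{(t,u,v): v=F(t,u)\}$$ is an integral set (integral surface) of the reduced system $$u'=B_+(t)u+g_+(t,z(t),z(\beta(t))),\qquad v'=B_-(t)v+g_-(t,z(t),z(\beta(t))).$$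
   Context: $\|\cdot\|$ is the Euclidean norm and the induced operator norm. $(\theta_i)_{i\in\mathbb Z}$ is a strictly increasing real sequence with $|\theta_i|\to\infty$ as $|i|\to\infty$ and $\theta_{i+1}-\theta_i\le\theta$ for all $i$, where $\theta>0$; $\beta(t)=\theta_i$ for $\theta_i\le t<\theta_{i+1}$. Exponential dichotomy: for a fundamental matrix $X(t)$ of $x'=A(t)x$ there is a projection $P$ with $\|X(t)PX^{-1}(s)\|\le Ke^{-\sigma(t-s)}$ for $t\ge s$ and $\|X(t)(I-P)X^{-1}(s)\|\le Ke^{-\sigma(s-t)}$ for $t\le s$. Reduced system: the equation $y'=A(t)y+f(t,y(t),y(\beta(t)))$ is transformed by $y=Q(t)z$, where $Q$ is a Lyapunov matrix ($C^1$, with $Q,Q',Q^{-1}$ bounded on $\mathbb R$) block-diagonalizing $x'=A(t)x$ according to the dichotomy, into the displayed system with $z=(u,v)$, $u\in\mathbb R^k$, $v\in\mathbb R^{n-k}$, $k=\operatorname{rank}P$, $\operatorname{diag}\{B_+,B_-\}=Q^{-1}AQ-Q^{-1}Q'$ and $(g_+,g_-)(t,z,w)=Q^{-1}(t)f(t,Q(t)z,Q(\beta(t))w)$. $L$ is a constant with $\|g_+(t,z_1,w_1)-g_+(t,z_2,w_2)\|+\|g_-(t,z_1,w_1)-g_-(t,z_2,w_2)\|\le L(\|z_1-z_2\|+\|w_1-w_2\|)$ for all $t\in\mathbb R$, $z_i,w_i\in\mathbb R^n$. The fundamental matrices $U(t,s)$, $V(t,s)$ of $u'=B_+(t)u$,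 $v'=B_-(t)v$ (with $U(s,s)=I$, $V(s,s)=I$) satisfy $\|U(t,s)\|\le Ke^{-\sigma(t-s)}$ for $t\ge s$ and $\|V(t,s)\|\le Ke^{-\sigma(s-t)}$ for $t\le s$. Solutions: a solution on $\mathbb R$ is a continuous function on $\mathbb R$, differentiable except possibly at the points $\theta_i$ (where the right derivative exists), satisfying the system on every $(\theta_i,\theta_{i+1})$ and with right derivatives at the $\theta_i$. A solution $z(t,t_0,z_0)$ with initial data $(t_0,z_0)$, $\theta_i\le t_0<\theta_{i+1}$, is a function on $[\theta_i,\infty)$ with the same properties there and $z(t_0)=z_0$; it is continued on $\mathbb R$ if it extends to a solution on $\mathbb R$. Function $F$: for $L$ sufficiently small (depending on $\epsilon,\alpha,K,\sigma,\theta$), $F$ is the continuous function with $F(t,0)=0$, $\|F(t,u_1)-F(t,u_2)\|\le\frac{2K^2L(1+e^{\sigma\theta})}{\sigma+\alpha}\|u_1-u_2\|$, such that for all $(t_0,u_0)$ the solution $z$ with $z(t_0)=(u_0,F(t_0,u_0))$ is continued on $\mathbb R$ and satisfies $\|z(t)\|\le(K+\epsilon)\|u_0\|e^{-\alpha(t-t_0)}$ for $t\ge t_0$. Integral set: a set $\Sigma$ in $(t,z)$-space such that for every $(t_0,z_0)\in\Sigma$ the solution $z(t)=z(t,t_0,z_0)$ is continuable on $\mathbb R$ and $(t,z(t))\in\Sigma$ for all $t\in\mathbb R$. *)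

(* Defs.v *)
From HB Require Import structures.
From mathcomp Require Import all_boot all_order all_algebra.
From mathcomp Require Import all_classical all_reals all_analysis.

Set Implicit Arguments.
Unset Strict Implicit.
Unset Printing Implicit Defensive.

Import Order.TTheory GRing.Theory Num.Theory.
Import numFieldNormedType.Exports.

Local Open Scope classical_set_scope.
Local Open Scope ring_scope.

(* The library norm on matrices is the maximum norm: it is used below only
   through the topology it induces (continuity, derivatives).  All estimates
   use the Euclidean norm [enorm] and its operator norm [opnorm]. *)
Definition enorm (R : realType) (n : nat) (x : 'cV[R]_n) : R :=
  Num.sqrt (\sum_(i < n) x i 0 ^+ 2).

Definition opnorm (R : realType) (m n : nat) (A : 'M[R]_(m, n)) : R :=
  sup [set enorm (A *m x) | x in [set x : 'cV[R]_n | enorm x <= 1]].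

Definition switching_sequence (R : realType) (th : int -> R) (theta : R) : Prop :=
  [/\ forall i j : int, i < j -> th i < th j,
      forall C : R, exists N : nat, forall i : int, (N <= absz i)%N -> C <= `|th i|
    & forall i : int, th (i + 1) - th i <= theta].

Definition argument_function (R : realType) (th : int -> R) (beta : R -> R) : Prop :=
  forall (i : int) (t : R), th i <= t < th (i + 1) -> beta t = th i.

Definition right_derivative (R : realType) (n : nat) (z : R -> 'cV[R]_n)
    (t : R) (d : 'cV[R]_n) : Prop :=
  h^-1 *: (z (t + h) - z t) @[h --> (0 : R)^'+] --> d.

(* Solutions of z'(t) = rhs t (z t) (z (beta t)) on D, where D is either the
   whole line or a half-line [th i, +oo): a switching point in D thus has the
   whole interval up to the next one in D. *)
Definition solution_on (R : realType) (n : nat) (th : int -> R) (beta : R -> R)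
    (rhs : R -> 'cV[R]_n -> 'cV[R]_n -> 'cV[R]_n)
    (D : set R) (z : R -> 'cV[R]_n) : Prop :=
  [/\ {within D, continuous z},
      forall (i : int) (t : R), D (th i) -> th i < t < th (i + 1) ->
        is_derive t 1 z (rhs t (z t) (z (beta t)))
    & forall i : int, D (th i) ->
        right_derivative z (th i) (rhs (th i) (z (th i)) (z (beta (th i))))].

(* z is z(., t0, z0), where th i <= t0 < th (i + 1); its values before th i are
   irrelevant. *)
Definition solution_from (R : realType) (n : nat) (th : int -> R) (beta : R -> R)
    (rhs : R -> 'cV[R]_n -> 'cV[R]_n -> 'cV[R]_n)
    (i : int) (t0 : R) (z0 : 'cV[R]_n) (z : R -> 'cV[R]_n) : Prop :=
  solution_on th beta rhs `[th i, +oo[ z /\ z t0 = z0.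

Definition continuation (R : realType) (n : nat) (th : int -> R) (beta : R -> R)
    (rhs : R -> 'cV[R]_n -> 'cV[R]_n -> 'cV[R]_n)
    (i : int) (z zbar : R -> 'cV[R]_n) : Prop :=
  solution_on th beta rhs setT zbar /\ forall t, th i <= t -> zbar t = z t.

(* Nothing is presupposed about existence or uniqueness of z(., t0, z0) or of
   its continuation: z(., t0, z0) exists, every version of it can be continued,
   and every continuation stays in S. *)
Definition integral_set (R : realType) (n : nat) (th : int -> R) (beta : R -> R)
    (rhs : R -> 'cV[R]_n -> 'cV[R]_n -> 'cV[R]_n)
    (S : set (R * 'cV[R]_n)) : Prop :=
  forall (i : int) (t0 : R) (z0 : 'cV[R]_n),
    S (t0, z0) -> th i <= t0 < th (i + 1) ->
    (exists z, solution_from th beta rhs i t0 z0 z) /\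
    (forall z, solution_from th beta rhs i t0 z0 z ->
       (exists zbar, continuation th beta rhs i z zbar) /\
       (forall zbar, continuation th beta rhs i z zbar ->
          forall t, S (t, zbar t))).

Definition fundamental_matrix (R : realType) (n : nat) (A X : R -> 'M[R]_n) : Prop :=
  forall t : R, is_derive t 1 X (A t *m X t) /\ X t \in unitmx.

Definition transition_matrix (R : realType) (n : nat) (B : R -> 'M[R]_n)
    (U : R -> R -> 'M[R]_n) : Prop :=
  forall s : R, U s s = 1%:M /\
    forall t : R, is_derive t 1 (fun r => U r s) (B t *m U t s).

Definition exp_dichotomy (R : realType) (n : nat) (A X : R -> 'M[R]_n)
    (P : 'M[R]_n) (K sigma : R) : Prop :=
  [/\ fundamental_matrix A X,
      P *m P = P,
      forall t s, s <= t ->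
        opnorm (X t *m P *m invmx (X s)) <= K * expR (- sigma * (t - s))
    & forall t s, t <= s ->
        opnorm (X t *m (1%:M - P) *m invmx (X s)) <= K * expR (- sigma * (s - t))].

Definition lyapunov_matrix (R : realType) (n : nat) (Q : R -> 'M[R]_n) : Prop :=
  [/\ forall t : R, derivable Q t 1, continuous (derive1 Q),
      forall t, Q t \in unitmx
    & exists C : R, forall t, [/\ opnorm (Q t) <= C,
        opnorm (derive1 Q t) <= C & opnorm (invmx (Q t)) <= C]].

(* The second condition says that the splitting z = (u, v) is the one given by
   the dichotomy: Q t maps R^k x {0} onto the range of the dichotomy projection
   X t P (X t)^-1 and {0} x R^p onto its kernel. *)
Definition block_diagonalizes (R : realType) (k p : nat)
    (A X : R -> 'M[R]_(k + p)) (P : 'M[R]_(k + p)) (Q : R -> 'M[R]_(k + p))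
    (Bp : R -> 'M[R]_k) (Bm : R -> 'M[R]_p) : Prop :=
  (forall t, invmx (Q t) *m A t *m Q t - invmx (Q t) *m derive1 Q t
             = block_mx (Bp t) 0 0 (Bm t)) /\
  (forall t, invmx (Q t) *m (X t *m P *m invmx (X t)) *m Q t
             = block_mx 1%:M 0 0 0).

Definition reduced_g (R : realType) (n : nat)
    (f : R -> 'cV[R]_n -> 'cV[R]_n -> 'cV[R]_n) (beta : R -> R)
    (Q : R -> 'M[R]_n) (t : R) (z w : 'cV[R]_n) : 'cV[R]_n :=
  invmx (Q t) *m f t (Q t *m z) (Q (beta t) *m w).

Definition g_plus (R : realType) (k p : nat)
    (f : R -> 'cV[R]_(k + p) -> 'cV[R]_(k + p) -> 'cV[R]_(k + p)) (beta : R -> R)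
    (Q : R -> 'M[R]_(k + p)) (t : R) (z w : 'cV[R]_(k + p)) : 'cV[R]_k :=
  usubmx (reduced_g f beta Q t z w).

Definition g_minus (R : realType) (k p : nat)
    (f : R -> 'cV[R]_(k + p) -> 'cV[R]_(k + p) -> 'cV[R]_(k + p)) (beta : R -> R)
    (Q : R -> 'M[R]_(k + p)) (t : R) (z w : 'cV[R]_(k + p)) : 'cV[R]_p :=
  dsubmx (reduced_g f beta Q t z w).

Definition reduced_rhs (R : realType) (k p : nat)
    (Bp : R -> 'M[R]_k) (Bm : R -> 'M[R]_p)
    (gp : R -> 'cV[R]_(k + p) -> 'cV[R]_(k + p) -> 'cV[R]_k)
    (gm : R -> 'cV[R]_(k + p) -> 'cV[R]_(k + p) -> 'cV[R]_p)
    (t : R) (z w : 'cV[R]_(k + p)) : 'cV[R]_(k + p) :=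
  col_mx (Bp t *m usubmx z + gp t z w) (Bm t *m dsubmx z + gm t z w).

Definition stable_manifold_function (R : realType) (k p : nat)
    (th : int -> R) (beta : R -> R)
    (rhs : R -> 'cV[R]_(k + p) -> 'cV[R]_(k + p) -> 'cV[R]_(k + p))
    (K sigma theta eps alpha L : R) (F : R -> 'cV[R]_k -> 'cV[R]_p) : Prop :=
  [/\ continuous (fun tu : R * 'cV[R]_k => F tu.1 tu.2),
      forall t, F t 0 = 0,
      forall t u1 u2, enorm (F t u1 - F t u2) <=
        2 * K ^+ 2 * L * (1 + expR (sigma * theta)) / (sigma + alpha)
          * enorm (u1 - u2)
    & forall t0 u0, exists z : R -> 'cV[R]_(k + p),
        [/\ solution_on th beta rhs setT z,
            z t0 = col_mx u0 (F t0 u0)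
          & forall t, t0 <= t ->
              enorm (z t) <= (K + eps) * enorm u0 * expR (- alpha * (t - t0))]].

Definition graph_surface (R : realType) (k p : nat) (F : R -> 'cV[R]_k -> 'cV[R]_p) :
    set (R * 'cV[R]_(k + p)) :=
  [set tz | dsubmx tz.2 = F tz.1 (usubmx tz.2)].

(* Main.v *)
(* Let d = z - w be the difference of two solutions of the reduced system on R that are
   bounded to the right, and d_u its stable component.

   At a switching point a the integral equations for d on [a, oo) involve no values
   before a; if the stable component of d vanishes at a, they give
   sup |d| <= (4KL/sigma) sup |d|, so d(a) = 0 once L <= sigma/(8K).  Taking for w the
   solution that starts on the graph of F above the same u shows that z(a) lies on the
   graph.

   Between switching points a < t < a' this fails, since beta(t) = a lies in the past
   and is not controlled by the dichotomy.  Instead, the hypothesis on l M theta gives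
   c |d(a)| <= |d(t)| <= C |d(a)| in the coordinates y = Q z (hence uniqueness in both
   time directions).  If all right-bounded solutions are on the graph at time t, then
   |d(t)| <= (1 + Lip F) |d_u(t)|, while d_u varies by at most C' h |d(a)| on
   [t, t + h]; so for a step h that does not depend on z and w, d_u(t + h) = 0 forces
   d_u(t) = 0 and d = 0.  Comparing z with the solution through
   (t + h, u(t + h), F(t + h, u(t + h))) puts z on the graph at time t + h. *)

Require Import Defs.
From HB Require Import structures.
From mathcomp Require Import all_boot all_order all_algebra.
From mathcomp Require Import all_classical all_reals all_analysis.
From mathcomp Require Import ring lra.
Import Order.TTheory GRing.Theory Num.Theory.
Import numFieldNormedType.Exports.
Local Open Scope classical_set_scope.
Local Open Scope ring_scope.
Set Implicit Arguments.
Unset Strict Implicit.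
Unset Printing Implicit Defensive.

(** * The Euclidean norm *)

Section EuclideanNorm.
Variables (R : realType).
Implicit Types (n : nat).

Lemma enorm_ge0 n (x : 'cV[R]_n) : 0 <= enorm x.
Proof. exact: sqrtr_ge0. Qed.

Lemma sqr_enorm n (x : 'cV[R]_n) : enorm x ^+ 2 = \sum_(i < n) x i 0 ^+ 2.
Proof. by rewrite sqr_sqrtr// sumr_ge0// => i _; exact: sqr_ge0. Qed.

Lemma enorm0 n : enorm (0 : 'cV[R]_n) = 0.
Proof. by rewrite /enorm big1 ?sqrtr0// => i _; rewrite mxE expr0n. Qed.

Lemma coord_le_enorm n (x : 'cV[R]_n) i : `|x i 0| <= enorm x.
Proof.
rewrite -sqrtr_sqr ler_sqrt; last by apply: sumr_ge0 => j _; exact: sqr_ge0.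
by rewrite (bigD1 i)//= lerDl sumr_ge0// => j _; exact: sqr_ge0.
Qed.

Lemma enorm_le0 n (x : 'cV[R]_n) : enorm x <= 0 -> x = 0.
Proof.
move=> x0; apply/matrixP => i j; rewrite ord1 mxE; apply/eqP.
by rewrite -normr_le0 (le_trans (coord_le_enorm x i)).
Qed.

Lemma enormZ n (a : R) (x : 'cV[R]_n) : enorm (a *: x) = `|a| * enorm x.
Proof.
rewrite /enorm -sqrtr_sqr -sqrtrM ?sqr_ge0// mulr_sumr.
by congr Num.sqrt; apply: eq_bigr => i _; rewrite mxE exprMn.
Qed.

Lemma enormN n (x : 'cV[R]_n) : enorm (- x) = enorm x.
Proof. by rewrite -scaleN1r enormZ normrN1 mul1r. Qed.

(** Cauchy-Schwarz: with [a = enorm x] and [b = enorm y], the sum of [(b x_i - a y_i)^2] equals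
    [2ab (ab - <x, y>)]. If [ab = 0], one of the vectors vanishes. *)
Lemma dot_le_enorm n (x y : 'cV[R]_n) :
  \sum_(i < n) x i 0 * y i 0 <= enorm x * enorm y.
Proof.
set a := enorm x; set b := enorm y.
have a0 : 0 <= a by exact: enorm_ge0.
have b0 : 0 <= b by exact: enorm_ge0.
have H : 0 <= \sum_(i < n) (b * x i 0 - a * y i 0) ^+ 2.
  by apply: sumr_ge0 => i _; exact: sqr_ge0.
have E : \sum_(i < n) (b * x i 0 - a * y i 0) ^+ 2 =
    2 * (a * b) * (a * b - \sum_(i < n) x i 0 * y i 0).
  transitivity (b ^+ 2 * (\sum_(i < n) x i 0 ^+ 2) + a ^+ 2 * (\sum_(i < n) y i 0 ^+ 2)
      - 2 * (a * b) * \sum_(i < n) x i 0 * y i 0).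
    rewrite !mulr_sumr -big_split/= -sumrB; apply: eq_bigr => i _; ring.
  rewrite -!sqr_enorm -/a -/b; ring.
have [ab0|ab0] := ltP 0 (a * b).
  move: H; rewrite E pmulr_rge0 ?subr_ge0//.
  by rewrite mulr_gt0.
have /eqP : a * b = 0 by apply/eqP; rewrite eq_le ab0 mulr_ge0.
have H0 m (u v : 'cV[R]_m) : enorm u = 0 -> \sum_(i < m) u i 0 * v i 0 = 0.
  move=> /eqP; rewrite eq_le => /andP[/enorm_le0 -> _].
  by rewrite big1// => i _; rewrite mxE mul0r.
rewrite mulf_eq0 => /orP[/eqP h|/eqP h]; first by rewrite h mul0r H0.
rewrite h mulr0; under eq_bigr do rewrite mulrC.
by rewrite H0.
Qed.

Lemma enormD n (x y : 'cV[R]_n) : enorm (x + y) <= enorm x + enorm y.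
Proof.
have xy0 : 0 <= enorm x + enorm y by rewrite addr_ge0// enorm_ge0.
rewrite -(ler_pXn2r (ltn0Sn 1)) ?nnegrE ?enorm_ge0//.
rewrite sqr_enorm sqrrD !sqr_enorm.
have -> : \sum_(i < n) (x + y) i 0 ^+ 2 = \sum_(i < n) x i 0 ^+ 2 +
    (\sum_(i < n) x i 0 * y i 0) *+ 2 + \sum_(i < n) y i 0 ^+ 2.
  rewrite -sumrMnl -!big_split/=; apply: eq_bigr => i _.
  by rewrite mxE sqrrD.
by rewrite lerD2r lerD2l lerMn2r dot_le_enorm orbT.
Qed.

Lemma enorm_sum_le n (x : 'cV[R]_n) : enorm x <= \sum_(i < n) `|x i 0|.
Proof.
have s0 : 0 <= \sum_(i < n) `|x i 0| by exact: sumr_ge0.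
rewrite -(ler_pXn2r (ltn0Sn 1)) ?nnegrE ?enorm_ge0// sqr_enorm expr2 mulr_suml.
apply: ler_sum => i _; rewrite -real_normK ?num_real// expr2 ler_wpM2l//.
by rewrite (bigD1 i)//= lerDl sumr_ge0.
Qed.

Lemma enorm_col_mx k p (u : 'cV[R]_k) (v : 'cV[R]_p) :
  enorm (col_mx u v) ^+ 2 = enorm u ^+ 2 + enorm v ^+ 2.
Proof.
rewrite !sqr_enorm big_split_ord/=; congr (_ + _); apply: eq_bigr => i _.
  by rewrite col_mxEu.
by rewrite col_mxEd.
Qed.

Lemma enorm_usubmx k p (z : 'cV[R]_(k + p)) : enorm (usubmx z) <= enorm z.
Proof.
rewrite -(ler_pXn2r (ltn0Sn 1)) ?nnegrE ?enorm_ge0//.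
by rewrite -{2}(vsubmxK z) enorm_col_mx lerDl sqr_ge0.
Qed.

Lemma enorm_dsubmx k p (z : 'cV[R]_(k + p)) : enorm (dsubmx z) <= enorm z.
Proof.
rewrite -(ler_pXn2r (ltn0Sn 1)) ?nnegrE ?enorm_ge0//.
by rewrite -{2}(vsubmxK z) enorm_col_mx lerDr sqr_ge0.
Qed.

Lemma enorm_le_split k p (z : 'cV[R]_(k + p)) :
  enorm z <= enorm (usubmx z) + enorm (dsubmx z).
Proof.
rewrite -(ler_pXn2r (ltn0Sn 1)) ?nnegrE ?addr_ge0 ?enorm_ge0//.
rewrite -{1}(vsubmxK z) enorm_col_mx sqrrD lerD2r lerDl mulrn_wge0//.
by rewrite mulr_ge0 ?enorm_ge0.
Qed.

Lemma enorm_mulmx_bound m n (A : 'M[R]_(m, n)) (x : 'cV[R]_n) :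
  enorm (A *m x) <= (\sum_(i < m) \sum_(j < n) `|A i j|) * enorm x.
Proof.
apply: (le_trans (enorm_sum_le _)); rewrite mulr_suml; apply: ler_sum => i _.
rewrite mxE mulr_suml; apply: (le_trans (ler_norm_sum _ _ _)).
by apply: ler_sum => j _; rewrite normrM ler_wpM2l ?coord_le_enorm.
Qed.

(** The [sup] in [opnorm] has its usual meaning only for a nonempty set bounded above; the sum of
    the absolute values of the entries is a bound. *)
Lemma opnorm_has_sup m n (A : 'M[R]_(m, n)) :
  has_sup [set enorm (A *m x) | x in [set x : 'cV[R]_n | enorm x <= 1]].
Proof.
split; first by exists (enorm (A *m 0)), 0 => //=; rewrite enorm0.
exists (\sum_(i < m) \sum_(j < n) `|A i j|) => _ [x /= x1 <-].
apply: (le_trans (enorm_mulmx_bound _ _)).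
by rewrite ler_piMr// sumr_ge0// => i _; rewrite sumr_ge0.
Qed.

Lemma opnorm_ge0 m n (A : 'M[R]_(m, n)) : 0 <= opnorm A.
Proof.
apply: ub_le_sup; first by case: (opnorm_has_sup A).
by exists 0; rewrite /= ?mulmx0 ?enorm0.
Qed.

Lemma enorm_mulmx m n (A : 'M[R]_(m, n)) (x : 'cV[R]_n) :
  enorm (A *m x) <= opnorm A * enorm x.
Proof.
have [x0|x0] := ltP 0 (enorm x); last first.
  by rewrite (enorm_le0 x0) mulmx0 !enorm0 mulr0.
rewrite -ler_pdivrMr// mulrC; apply: ub_le_sup.
  by case: (opnorm_has_sup A).
exists ((enorm x)^-1 *: x); rewrite /=.
  by rewrite enormZ ger0_norm ?invr_ge0 ?enorm_ge0// mulVf// gt_eqF.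
by rewrite -scalemxAr enormZ ger0_norm// invr_ge0 enorm_ge0.
Qed.

End EuclideanNorm.

(** * Right derivatives *)

Section RightPrimitive.
Variable R : realType.
Implicit Types (f g : R -> R) (a b t d l : R).

Lemma near_eq_cvg_to (F : set_system R) {FF : Filter F} f g l l' :
  f @ F --> l -> l = l' -> (\forall x \near F, f x = g x) -> g @ F --> l'.
Proof. by move=> fl <- fg; apply: cvg_trans fl; exact: near_eq_cvg. Qed.

(** Scalar form of [right_derivative]; at a switching point a solution is only known to have this
    one-sided derivative. *)
Definition rder f t d := h^-1 * (f (t + h) - f t) @[h --> (0 : R)^'+] --> d.

Lemma rder_continuous f t d : rder f t d -> f (t + h) @[h --> (0 : R)^'+] --> f t.
Proof.
move=> ft; have h0 : h @[h --> (0 : R)^'+] --> (0 : R).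
  exact: cvg_within.
apply: (near_eq_cvg_to (cvgD (cvgM h0 ft) (cvg_cst (f t)))).
  by rewrite mul0r add0r.
near=> h.
by rewrite !fctE/= mulrA divff ?mul1r ?subrK//.
Unshelve. all: by end_near. Qed.

Lemma rder_cst c t : rder (fun=> c) t 0.
Proof.
apply: (near_eq_cvg_to (cvg_cst 0)) => //; near=> h.
by rewrite subrr mulr0.
Unshelve. all: by end_near. Qed.

Lemma rderD f g t d e : rder f t d -> rder g t e ->
  rder (fun s => f s + g s) t (d + e).
Proof.
move=> ft gt; rewrite /rder.
apply: (near_eq_cvg_to (cvgD ft gt)) => //; near=> h.
by rewrite !fctE/= -mulrDr; congr (_ * _); ring.
Unshelve. all: by end_near. Qed.

Lemma rderM f g t d e : rder f t d -> rder g t e ->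
  rder (fun s => f s * g s) t (d * g t + f t * e).
Proof.
move=> ft gt; rewrite /rder.
apply: (near_eq_cvg_to
  (cvgD (cvgM ft (cvg_cst (g t))) (cvgM (rder_continuous ft) gt))) => //.
near=> h.
(* The increment of the product is split as [(f (t + h) - f t) * g t + f (t + h) * (g (t + h) - g
   t)], so right continuity of [f] is used. *)
by rewrite !fctE/=; ring.
Unshelve. all: by end_near. Qed.

Lemma rder_sum n (f : 'I_n -> R -> R) t (d : 'I_n -> R) :
  (forall i, rder (f i) t (d i)) ->
  rder (fun s => \sum_(i < n) f i s) t (\sum_(i < n) d i).
Proof.
elim: n f d => [|n IH] f d fd.
  rewrite big_ord0; have -> : (fun s => \sum_(i < 0) f i s) = fun=> 0.
    by apply/funext => s; rewrite big_ord0.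
  exact: rder_cst.
rewrite big_ord_recl.
have -> : (fun s => \sum_(i < n.+1) f i s) =
    fun s => f ord0 s + \sum_(i < n) f (lift ord0 i) s.
  by apply/funext => s; rewrite big_ord_recl.
by apply: rderD; [exact: fd|apply: IH => i; exact: fd].
Qed.

Lemma rder_sqrt f t d : (forall s, 0 < f s) -> rder f t d ->
  rder (fun s => Num.sqrt (f s)) t (d / (2 * Num.sqrt (f t))).
Proof.
move=> f0 ft; rewrite /rder.
have s0 s : 0 < Num.sqrt (f s) by rewrite sqrtr_gt0.
have fc : Num.sqrt (f (t + h)) + Num.sqrt (f t) @[h --> (0 : R)^'+] -->
    2 * Num.sqrt (f t).
  have -> : 2 * Num.sqrt (f t) = Num.sqrt (f t) + Num.sqrt (f t) by ring.
  apply: cvgD; last exact: cvg_cst.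
  by apply: continuous_cvg; [exact: sqrt_continuous|exact: rder_continuous ft].
have s2 : 2 * Num.sqrt (f t) != 0 by rewrite mulf_neq0 ?gt_eqF.
apply: (near_eq_cvg_to (cvgM ft (cvgV s2 fc))) => //; near=> h.
(* Conjugate trick: [u - v = (u^2 - v^2) / (u + v)] for the square roots [u], [v]. *)
rewrite /= -mulrA; congr (_ * _).
set u := Num.sqrt (f (t + h)); set v := Num.sqrt (f t).
have -> : f (t + h) = u ^+ 2 by rewrite sqr_sqrtr// ltW.
have -> : f t = v ^+ 2 by rewrite sqr_sqrtr// ltW.
by rewrite subr_sqr mulfK// gt_eqF// addr_gt0 ?s0.
Unshelve. all: by end_near. Qed.

Lemma is_derive_rder f t d : is_derive t 1 f d -> rder f t d.
Proof.
move=> [/cvg_ex[l fl] fd]; have : l = d.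
  by rewrite -fd; apply/esym; exact: cvg_lim.
move=> ld; move: fl; rewrite ld => /cvgrPdist_le fl.
apply/cvgrPdist_le => e e0; have [/= r r0 H] := fl _ e0.
exists r => //= h /= hr h0; have := H h hr.
by rewrite gt_eqF// => /(_ isT); rewrite /GRing.scale/= mulr1 (addrC t).
Qed.

(* This is all that a solution satisfies across switching points, and it is enough
   for monotonicity. *)
Definition right_primitive a b f f' :=
  (forall t, a <= t < b -> rder f t (f' t)) /\
  (forall t, a < t <= b -> f x @[x --> t^'-] --> f t).

Lemma right_primitiveW a b c e f f' : a <= c -> e <= b ->
  right_primitive a b f f' -> right_primitive c e f f'.
Proof.
move=> ac eb [fd fc]; split=> t /andP[t1 t2].
  by apply: fd; rewrite (le_trans ac)//= (lt_le_trans t2).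
by apply: fc; rewrite (le_lt_trans ac)//= (le_trans t2).
Qed.

Lemma right_primitive_eq a b f f' g g' :
  (forall t, a <= t <= b -> f t = g t) ->
  (forall t, a <= t < b -> f' t = g' t) ->
  right_primitive a b f f' -> right_primitive a b g g'.
Proof.
move=> fg fg' [fd fc]; split=> t /andP[t1 t2].
  have tab : a <= t < b by rewrite t1.
  apply: (near_eq_cvg_to (fd t tab)); first exact: fg'.
  near=> h.
  rewrite !fg ?t1 ?(ltW t2)//; apply/andP; split.
    by rewrite (le_trans t1)// lerDl; near: h; exact: nbhs_right_ge.
  by rewrite -lerBrDl ltW//; near: h; apply: nbhs_right_lt; rewrite subr_gt0.
have tab : a < t <= b by rewrite t1.
apply: (near_eq_cvg_to (fc t tab)); first by rewrite fg// (ltW t1).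
near=> h.
rewrite fg//; apply/andP; split.
  by rewrite ltW//; near: h; exact: nbhs_left_gt.
by rewrite (le_trans _ t2)//; near: h; exact: nbhs_left_le.
Unshelve. all: by end_near. Qed.

Lemma right_primitive_cst a b c : right_primitive a b (fun=> c) (fun=> 0).
Proof. by split=> t _; [exact: rder_cst|exact: cvg_cst]. Qed.

Lemma right_primitive_deriv a b f f' :
  (forall t, is_derive t 1 f (f' t)) -> right_primitive a b f f'.
Proof.
move=> fd; split=> t _; first exact: is_derive_rder.
apply: cvg_at_left_filter; apply: differentiable_continuous.
by apply/derivable1_diffP; case: (fd t).
Qed.

Lemma right_primitiveD a b f f' g g' :
  right_primitive a b f f' -> right_primitive a b g g' ->
  right_primitive a b (fun t => f t + g t) (fun t => f' t + g' t).
Proof.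
move=> [fd fc] [gd gc]; split=> t tab; first by apply: rderD; [exact: fd|exact: gd].
by apply: cvgD; [exact: fc|exact: gc].
Qed.

Lemma right_primitiveM a b f f' g g' :
  right_primitive a b f f' -> right_primitive a b g g' ->
  right_primitive a b (fun t => f t * g t) (fun t => f' t * g t + f t * g' t).
Proof.
move=> [fd fc] [gd gc]; split=> t tab; first by apply: rderM; [exact: fd|exact: gd].
by apply: cvgM; [exact: fc|exact: gc].
Qed.

Lemma right_primitiveZ a b c f f' : right_primitive a b f f' ->
  right_primitive a b (fun t => c * f t) (fun t => c * f' t).
Proof.
move=> fd; have := right_primitiveM (right_primitive_cst a b c) fd.
by apply: right_primitive_eq => // t _; rewrite mul0r add0r.
Qed.

Lemma right_primitiveB a b f f' g g' :
  right_primitive a b f f' -> right_primitive a b g g' ->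
  right_primitive a b (fun t => f t - g t) (fun t => f' t - g' t).
Proof.
move=> fd /(right_primitiveZ (-1)) gd; have := right_primitiveD fd gd.
by apply: right_primitive_eq => // t _; rewrite mulN1r.
Qed.

Lemma right_primitive_sum a b n (f f' : 'I_n -> R -> R) :
  (forall i, right_primitive a b (f i) (f' i)) ->
  right_primitive a b (fun t => \sum_(i < n) f i t) (fun t => \sum_(i < n) f' i t).
Proof.
move=> fd; split=> t tab; first by apply: rder_sum => i; exact: (fd i).1.
by apply: cvg_big => [|i _]; [exact: add_continuous|exact: (fd i).2].
Qed.

Lemma right_primitive_sqrt a b f f' : (forall t, 0 < f t) ->
  right_primitive a b f f' ->
  right_primitive a b (fun t => Num.sqrt (f t)) (fun t => f' t / (2 * Num.sqrt (f t))).
Proof.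
move=> f0 [fd fc]; split=> t tab; first by apply: rder_sqrt => //; exact: fd.
by apply: continuous_cvg; [exact: sqrt_continuous|exact: fc].
Qed.

(** Continuous induction with a slack [e]: the bound [f s <= f a + e * (s - a)] reaches the supremum
    [c] of the times up to which it holds by left continuity, and passes beyond [c] because the
    right derivative there is below [e]. *)
Lemma right_primitive_mono a b f f' : a <= b -> right_primitive a b f f' ->
  (forall t, a <= t < b -> f' t <= 0) -> f b <= f a.
Proof.
move=> ab [fd fc] f'0; apply/ler_addgt0Pr => e0 e0_gt0.
(* This gives [e * (b - a) <= e0]; the summand 1 covers [a = b]. *)
pose e := e0 / (b - a + 1).
have ba0 : 0 < b - a + 1 by rewrite ltr_wpDl ?subr_ge0.
have e_gt0 : 0 < e by rewrite divr_gt0.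
suff : f b <= f a + e * (b - a).
  move/le_trans; apply; rewrite lerD2l /e mulrAC ler_pdivrMr// ler_wpM2l ?ltW//.
  by rewrite ltrDl.
pose E := [set t | a <= t <= b /\ forall s, a <= s <= t -> f s <= f a + e * (s - a)].
have Ea : E a.
  split; first by rewrite lexx.
  by move=> s; rewrite -eq_le => /eqP <-; rewrite subrr mulr0 addr0.
have Eb : ubound E b by move=> t [/andP[]].
have sE : has_sup E by split; [exists a|exists b].
pose c := sup E.
have ac : a <= c by apply: ub_le_sup => //; exists b.
have cb : c <= b by apply: ge_sup => //; exists a.
have Elt s : a <= s < c -> f s <= f a + e * (s - a).
  move=> /andP[as_ sc].
  have [t [tb Et] st] := sup_gt (ex_intro _ a Ea) sc.
  by apply: Et; rewrite as_ ltW.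
have Ec : f c <= f a + e * (c - a).
  move: ac; rewrite le_eqVlt => /predU1P[<-|ac]; first by rewrite subrr mulr0 addr0.
  have fcc : f x @[x --> c^'-] --> f c by apply: fc; rewrite ac.
  have gcc : f a + e * (x - a) @[x --> c^'-] --> f a + e * (c - a).
    apply: cvgD; [exact: cvg_cst|apply: cvgM; [exact: cvg_cst|]].
    by apply: cvgB; [exact: cvg_within|exact: cvg_cst].
  apply: ler_cvg_to fcc gcc _; near=> x; apply: Elt; apply/andP; split.
    by rewrite ltW//; near: x; exact: nbhs_left_gt.
  by near: x; exact: nbhs_left_lt.
move: cb; rewrite le_eqVlt => /predU1P[cb|cb]; first by rewrite -cb.
exfalso.
have fdc : rder f c (f' c) by apply: fd; rewrite ac.
have : \forall h \near (0 : R)^'+, h^-1 * (f (c + h) - f c) <= e.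
  have e1 : f' c < e by apply: le_lt_trans e_gt0; apply: f'0; rewrite ac.
  have := fdc; move=> /cvgrPdist_lt /(_ (e - f' c)); rewrite subr_gt0 => /(_ e1).
  apply: filterS => h; rewrite ltr_norml => /andP[H _].
  by rewrite ltW//; lra.
move=> [/= r r0 H].
(* The difference quotient at [c] is at most [e] for increments below [r], so the bound extends to
   [c + d], against the choice of [c]. *)
pose d := Num.min (r / 2) (b - c).
have d0 : 0 < d by rewrite lt_min divr_gt0//= subr_gt0.
suff : E (c + d).
  move=> Ecd; have : c + d <= c by apply: ub_le_sup => //; exists b.
  by rewrite gerDl leNgt d0.
split.
  rewrite (le_trans ac) ?lerDl ?(ltW d0)//=.
  by rewrite -lerBrDl ge_min lexx orbT.
move=> s /andP[as_ scd]; have [sc|cs] := leP s c.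
  move: sc; rewrite le_eqVlt => /predU1P[->//|sc].
  by apply: Elt; rewrite as_.
have sc0 : 0 < s - c by rewrite subr_gt0.
have := H (s - c) _ sc0; rewrite /= sub0r normrN gtr0_norm//.
have dr : d < r by rewrite gt_min; apply/orP; left; rewrite ltr_pdivrMr//; lra.
have -> : s - c < r by lra.
have -> : c + (s - c) = s by ring.
move=> /(_ isT); rewrite mulrC ler_pdivrMr// => h.
have -> : e * (s - a) = e * (s - c) + e * (c - a) by ring.
by lra.
Unshelve. all: by end_near. Qed.

End RightPrimitive.

(** * Comparison and Gronwall inequalities *)

Section MatrixPrimitive.
Variable R : realType.
Implicit Types (a b t : R).

Definition mx_primitive m n a b (Z Z' : R -> 'M[R]_(m, n)) :=
  forall i j, right_primitive a b (fun t => Z t i j) (fun t => Z' t i j).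

Lemma mx_primitiveW m n a b c e (Z Z' : R -> 'M[R]_(m, n)) : a <= c -> e <= b ->
  mx_primitive a b Z Z' -> mx_primitive c e Z Z'.
Proof. by move=> ac eb ZZ' i j; exact: right_primitiveW (ZZ' i j). Qed.

Lemma mx_primitive_eq m n a b (Z Z' Y Y' : R -> 'M[R]_(m, n)) :
  (forall t, a <= t <= b -> Z t = Y t) ->
  (forall t, a <= t < b -> Z' t = Y' t) ->
  mx_primitive a b Z Z' -> mx_primitive a b Y Y'.
Proof.
move=> ZY ZY' H i j; apply: right_primitive_eq (H i j) => t tab.
  by rewrite ZY.
by rewrite ZY'.
Qed.

Lemma mx_primitive_cst m n a b (Z : 'M[R]_(m, n)) :
  mx_primitive a b (fun=> Z) (fun=> 0).
Proof.
move=> i j; apply: right_primitive_eq (right_primitive_cst a b (Z i j)) => // t _.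
by rewrite mxE.
Qed.

Lemma mx_primitiveB m n a b (Z Z' Y Y' : R -> 'M[R]_(m, n)) :
  mx_primitive a b Z Z' -> mx_primitive a b Y Y' ->
  mx_primitive a b (fun t => Z t - Y t) (fun t => Z' t - Y' t).
Proof.
move=> ZZ' YY' i j; apply: right_primitive_eq (right_primitiveB (ZZ' i j) (YY' i j)).
  by move=> t _; rewrite !mxE.
by move=> t _; rewrite !mxE.
Qed.

Lemma mx_primitive_mul m n p a b (Z Z' : R -> 'M[R]_(m, n)) (Y Y' : R -> 'M[R]_(n, p)) :
  mx_primitive a b Z Z' -> mx_primitive a b Y Y' ->
  mx_primitive a b (fun t => Z t *m Y t) (fun t => Z' t *m Y t + Z t *m Y' t).
Proof.
move=> ZZ' YY' i j.
apply: right_primitive_eq (right_primitive_sum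
  (fun k => right_primitiveM (ZZ' i k) (YY' k j))) => t _ /=.
  by rewrite mxE.
by rewrite !mxE -big_split.
Qed.

Lemma mx_primitive_usubmx k p a b (Z Z' : R -> 'cV[R]_(k + p)) :
  mx_primitive a b Z Z' ->
  mx_primitive a b (fun t => usubmx (Z t)) (fun t => usubmx (Z' t)).
Proof.
move=> ZZ' i j; apply: right_primitive_eq (ZZ' (lshift p i) j) => t _.
  by rewrite mxE.
by rewrite mxE.
Qed.

Lemma mx_primitive_dsubmx k p a b (Z Z' : R -> 'cV[R]_(k + p)) :
  mx_primitive a b Z Z' ->
  mx_primitive a b (fun t => dsubmx (Z t)) (fun t => dsubmx (Z' t)).
Proof.
move=> ZZ' i j; apply: right_primitive_eq (ZZ' (rshift k i) j) => t _.
  by rewrite mxE.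
by rewrite mxE.
Qed.

Lemma is_derive_coord m n (Z : R -> 'M[R]_(m, n)) t (D : 'M[R]_(m, n)) i j :
  is_derive t 1 Z D -> is_derive t 1 (fun s => Z s i j) (D i j).
Proof.
move=> [/cvg_ex[l Zl] ZD]; have lD : l = D.
  by rewrite -ZD; apply/esym; exact: cvg_lim.
rewrite lD in Zl.
have H : h^-1 *: ((fun s => Z s i j) (h *: 1 + t) - Z t i j) @[h --> 0^'] --> D i j.
  apply: (near_eq_cvg_to (cvg_comp _ _ Zl (@coord_continuous _ m n i j D))) => //.
  by near=> h; rewrite /= !mxE.
split; first by apply/cvg_ex; exists (D i j).
exact: cvg_lim H.
Unshelve. all: by end_near. Qed.

Lemma mx_primitive_deriv m n a b (Z Z' : R -> 'M[R]_(m, n)) :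
  (forall t, is_derive t 1 Z (Z' t)) -> mx_primitive a b Z Z'.
Proof.
move=> ZZ' i j; apply: right_primitive_deriv => t.
exact: is_derive_coord (ZZ' t).
Qed.

Lemma right_derivative_coord n (z : R -> 'cV[R]_n) t d i :
  right_derivative z t d -> rder (fun s => z s i 0) t (d i 0).
Proof.
move=> zd.
apply: (@near_eq_cvg_to _ (0 : R)^'+ _ _ _ _ _ (cvg_comp _ _ zd (@coord_continuous _ n 1 i 0 d))) => //.
by near=> h; rewrite /= !mxE.
Unshelve. all: by end_near. Qed.

(* [enorm] is not differentiable at 0, so it is approximated by
   [sqrt (enorm z ^+ 2 + e ^+ 2)]. *)
Lemma enorm_regularized n a b e (z z' : R -> 'cV[R]_n) : 0 < e ->
  mx_primitive a b z z' ->
  exists r r' : R -> R, [/\ right_primitive a b r r',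
    forall t, enorm (z t) <= r t <= enorm (z t) + e &
    forall t, `|r' t| <= enorm (z' t)].
Proof.
move=> e0 zz'.
pose f t := \sum_(i < n) z t i 0 * z t i 0 + e ^+ 2.
pose f' t := \sum_(i < n) (z' t i 0 * z t i 0 + z t i 0 * z' t i 0) + 0.
have ff' : right_primitive a b f f'.
  apply: right_primitiveD (right_primitive_cst _ _ _).
  apply: right_primitive_sum => i; exact: right_primitiveM.
have fE t : f t = enorm (z t) ^+ 2 + e ^+ 2.
  by rewrite /f sqr_enorm; congr (_ + _); apply: eq_bigr => i _; rewrite expr2.
have f0 t : 0 < f t by rewrite fE ltr_wpDl ?sqr_ge0// exprn_gt0.
have s0 t : 0 < Num.sqrt (f t) by rewrite sqrtr_gt0.
have zr t : enorm (z t) <= Num.sqrt (f t).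
  rewrite -(ler_pXn2r (ltn0Sn 1)) ?nnegrE ?enorm_ge0 ?sqrtr_ge0//.
  by rewrite (sqr_sqrtr (ltW (f0 t))) fE lerDl sqr_ge0.
exists (fun t => Num.sqrt (f t)), (fun t => f' t / (2 * Num.sqrt (f t))); split.
- exact: right_primitive_sqrt.
- move=> t; rewrite zr/= -(ler_pXn2r (ltn0Sn 1)) ?nnegrE ?sqrtr_ge0 ?addr_ge0 ?enorm_ge0 ?(ltW e0)//.
  rewrite (sqr_sqrtr (ltW (f0 t))) fE sqrrD lerD2r lerDl mulrn_wge0//.
  by rewrite mulr_ge0 ?enorm_ge0 ?(ltW e0).
- move=> t; have -> : f' t = 2 * \sum_(i < n) z t i 0 * z' t i 0.
    rewrite /f' addr0 mulr_sumr; apply: eq_bigr => i _; ring.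
  rewrite -mulf_div divff// mul1r normrM normfV (gtr0_norm (s0 t)) ler_pdivrMr//.
  rewrite mulrC; apply: le_trans (_ : enorm (z t) * enorm (z' t) <= _); last first.
    by rewrite ler_wpM2r ?enorm_ge0.
  rewrite ler_norml dot_le_enorm andbT lerNl.
  have := dot_le_enorm (- z t) (z' t); rewrite enormN; apply: le_trans.
  by rewrite -sumrN ler_sum// => i _; rewrite mxE mulNr.
Qed.

(** Takes the place of estimating the integral of [z']: for the regularized norm [r], both [r - psi]
    and [- r - psi] are nonincreasing. The second inequality serves estimates backward in time. *)
Lemma enorm_comparison n a b (z z' : R -> 'cV[R]_n) (psi psi' : R -> R) :
  a <= b -> mx_primitive a b z z' -> right_primitive a b psi psi' ->
  (forall t, a <= t < b -> enorm (z' t) <= psi' t) ->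
  enorm (z b) <= enorm (z a) + (psi b - psi a) /\
  enorm (z a) <= enorm (z b) + (psi b - psi a).
Proof.
move=> ab zz' pp' zp.
suff H e : 0 < e -> enorm (z b) <= enorm (z a) + (psi b - psi a) + e /\
    enorm (z a) <= enorm (z b) + (psi b - psi a) + e.
  by split; apply/ler_addgt0Pr => e /H[].
move=> e0; have [r [r' [rr' zr r'z]]] := enorm_regularized e0 zz'.
have r'p t : a <= t < b -> `|r' t| <= psi' t.
  by move=> tab; apply: le_trans (r'z t) (zp t tab).
have /andP[za ra] := zr a; have /andP[zb rb] := zr b.
have H1 : r b - psi b <= r a - psi a.
  apply: (right_primitive_mono ab (right_primitiveB rr' pp')) => t /r'p.
  by rewrite subr_le0 ler_norml => /andP[].
have H2 : -1 * r b - psi b <= -1 * r a - psi a.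
  apply: (right_primitive_mono ab
    (right_primitiveB (right_primitiveZ (-1) rr') pp')) => t /r'p.
  by rewrite subr_le0 mulN1r ler_norml => /andP[]; lra.
by split; lra.
Qed.

Lemma is_derive_expR_linear (c d t : R) :
  is_derive t 1 (fun s : R => expR (c * (s - d))) (c * expR (c * (t - d))).
Proof.
have H : is_derive t 1 (fun s : R => c * (s - d)) c.
  have -> : (fun s : R => c * (s - d)) = c \*: ((fun s : R => s) - cst d).
    by apply/funext => s; rewrite !fctE.
  apply: is_derive_eq; by rewrite subr0 scaler1.
have := @is_derive1_comp _ (@expR R) _ _ _ _ (is_derive_expR _) H.
by rewrite mulrC.
Qed.

Lemma is_derive_linear (c d t : R) : is_derive t 1 (fun s : R => c * (s - d)) c.
Proof.
have -> : (fun s : R => c * (s - d)) = c \*: ((fun s : R => s) - cst d).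
  by apply/funext => s; rewrite !fctE.
by apply: is_derive_eq; rewrite subr0 scaler1.
Qed.

(** Gronwall in both time directions, obtained by applying monotonicity to the regularized norm
    times an exponential integrating factor, corrected by a linear term for the forcing [k]. *)
Lemma enorm_gronwall n a b c k (z z' : R -> 'cV[R]_n) :
  a <= b -> 0 <= c -> 0 <= k -> mx_primitive a b z z' ->
  (forall t, a <= t < b -> enorm (z' t) <= c * enorm (z t) + k) ->
  enorm (z b) <= expR (c * (b - a)) * (enorm (z a) + k * (b - a)) /\
  enorm (z a) <= expR (c * (b - a)) * (enorm (z b) + k * (b - a)).
Proof.
move=> ab c0 k0 zz' zc.
set E := expR (c * (b - a)); have E0 : 0 < E by exact: expR_gt0.
suff H e : 0 < e -> enorm (z b) <= E * (enorm (z a) + k * (b - a)) + e /\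
    enorm (z a) <= E * (enorm (z b) + k * (b - a)) + e.
  by split; apply/ler_addgt0Pr => e /H[].
(* The regularization error gets multiplied by [E] in the estimates, hence the division. *)
move: e => eE eE0; pose e := eE / E.
have e0 : 0 < e by rewrite divr_gt0.
have -> : eE = E * e by rewrite /e mulrC divfK// gt_eqF.
have [r [r' [rr' zr r'z]]] := enorm_regularized e0 zz'.
have r'p t : a <= t < b -> `|r' t| <= c * r t + k.
  move=> tab; apply: le_trans (r'z t) _; apply: le_trans (zc t tab) _.
  by rewrite lerD2r ler_wpM2l//; have /andP[] := zr t.
have /andP[za ra] := zr a; have /andP[zb rb] := zr b.
have lin := right_primitive_deriv a b (is_derive_linear k a).
split.
- have up := right_primitiveB
    (right_primitiveM (right_primitive_deriv a b (is_derive_expR_linear (- c) a)) rr') lin.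
  have {up} : expR (- c * (b - a)) * r b - k * (b - a) <=
              expR (- c * (a - a)) * r a - k * (a - a).
    apply: (right_primitive_mono ab up) => t tab.
    have /andP[ta tb] := tab.
    have := r'p t tab; rewrite ler_norml => /andP[_ h].
    set x := expR _; have x0 : 0 < x by exact: expR_gt0.
    have x1 : x <= 1.
      by rewrite -expR0 ler_expR mulNr oppr_le0 mulr_ge0// subr_ge0.
    have : x * r' t <= x * (c * r t + k) by rewrite ler_pM2l.
    have : x * k <= k by rewrite ler_piMl.
    by lra.
  rewrite !subrr !mulr0 expR0 mul1r subr0 mulNr expRN -/E lerBlDr mulrC ler_pdivrMr//.
  move=> h; apply: (le_trans zb); apply: (le_trans h).
  by rewrite mulrC -mulrDr ler_pM2l//; lra.
(* Backward in time the factor is [expR (c * (t - a))], which only satisfies [x <= E]; this is why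
   the linear correction carries the factor [E]. *)
- have down := right_primitiveB (right_primitiveZ (-1)
    (right_primitiveM (right_primitive_deriv a b (is_derive_expR_linear c a)) rr'))
    (right_primitiveZ E lin).
  have {down} : -1 * (expR (c * (b - a)) * r b) - E * (k * (b - a)) <=
              -1 * (expR (c * (a - a)) * r a) - E * (k * (a - a)).
    apply: (right_primitive_mono ab down) => t tab.
    have /andP[ta tb] := tab.
    have := r'p t tab; rewrite ler_norml => /andP[h _].
    set x := expR _; have x0 : 0 < x by exact: expR_gt0.
    have xE : x <= E.
      by rewrite ler_expR ler_wpM2l// lerD2r ltW.
    have : x * - (c * r t + k) <= x * r' t by rewrite ler_pM2l.
    have : x * k <= E * k by rewrite ler_wpM2r.
    by lra.
  rewrite -/E !subrr !mulr0 expR0 mul1r.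
  have : E * r b <= E * (enorm (z b) + e) by rewrite ler_pM2l.
  by lra.
Qed.

End MatrixPrimitive.

(** * Transition matrices *)

Section TransitionMatrix.
Variables (R : realType) (n : nat) (B : R -> 'M[R]_n) (U : R -> R -> 'M[R]_n) (b : R).
Hypotheses (b_ge0 : 0 <= b) (Bb : forall t x, enorm (B t *m x) <= b * enorm x).
Hypothesis UB : transition_matrix B U.

Lemma linear_system_bound (s t : R) (z : R -> 'cV[R]_n) :
  s <= t -> mx_primitive s t z (fun r => B r *m z r) ->
  enorm (z t) <= expR (b * (t - s)) * enorm (z s) /\
  enorm (z s) <= expR (b * (t - s)) * enorm (z t).
Proof.
move=> st zB; have := enorm_gronwall st b_ge0 (lexx 0) zB.
by rewrite !mul0r !addr0; apply => r _; rewrite addr0.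
Qed.

Lemma transition_primitive (a c s : R) (x : 'cV[R]_n) :
  mx_primitive a c (fun r => U r s *m x) (fun r => B r *m (U r s *m x)).
Proof.
apply: mx_primitive_eq (mx_primitive_mul
  (mx_primitive_deriv a c (UB s).2) (mx_primitive_cst a c x)) => //.
by move=> t _; rewrite mulmx0 addr0 mulmxA.
Qed.

Lemma transition_bound (t s : R) (x : 'cV[R]_n) :
  enorm (U t s *m x) <= expR (b * `|t - s|) * enorm x.
Proof.
have [st|/ltW ts] := leP s t.
  rewrite ger0_norm ?subr_ge0//.
  by have [+ _] := linear_system_bound st (transition_primitive s t s x); rewrite (UB s).1 mul1mx.
rewrite distrC ger0_norm ?subr_ge0//.
by have [_] := linear_system_bound ts (transition_primitive t s s x); rewrite (UB s).1 mul1mx.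
Qed.

Lemma mulmx_ext m p (M N : 'M[R]_(m, p)) : (forall x : 'cV[R]_p, M *m x = N *m x) -> M = N.
Proof.
move=> MN; apply/trmx_inj/row_matrixP => i.
by rewrite -!tr_col !colE MN.
Qed.

(** As functions of [t] both sides solve the same linear system and agree at [t = r]; the Gronwall
    bound gives uniqueness on either side of [r]. *)
Lemma transition_cocycle (t r s : R) : U t r *m U r s = U t s.
Proof.
apply: mulmx_ext => x; apply/eqP; rewrite -subr_eq0; apply/eqP; apply: enorm_le0.
pose z q := U q r *m U r s *m x - U q s *m x.
have zP a c : mx_primitive a c z (fun q => B q *m z q).
  apply: mx_primitive_eq (mx_primitiveB (transition_primitive a c r (U r s *m x))
    (transition_primitive a c s x)) => q _; rewrite /z ?mulmxA//.
  by rewrite mulmxBr !mulmxA.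
have zr : enorm (z r) = 0 by rewrite /z (UB r).1 mul1mx subrr enorm0.
have [rt|/ltW tr] := leP r t.
  by have [+ _] := linear_system_bound rt (zP r t); rewrite zr mulr0.
by have [_] := linear_system_bound tr (zP t r); rewrite zr mulr0.
Qed.

(** [transition_matrix] speaks only of the first argument. Continuity in the second follows from
    [I - U s r = U s r (U r s - I)], where [U s r] is bounded by [expR (b * |s - r|)]. *)
Lemma transition_left_continuous_id (s : R) i j :
  U s r i j @[r --> s] --> (1%:M : 'M[R]_n) i j.
Proof.
have H : expR (b * `|s - r|) * \sum_(k < n) `|(1%:M : 'M[R]_n) k j - U r s k j| @[r --> s] --> (0 : R).
  rewrite [X in _ --> X](_ : _ = expR (b * `|s - s|) *
      \sum_(k < n) `|(1%:M : 'M[R]_n) k j - U s s k j|); last first.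
    by rewrite (UB s).1 big1 ?mulr0// => k _; rewrite subrr normr0.
  apply: cvgM.
    apply: continuous_cvg; first exact: continuous_expR.
    apply: cvgM; first exact: cvg_cst.
    by apply: cvg_norm; apply: cvgB; [exact: cvg_cst|exact: cvg_id].
  apply: cvg_big => [|k _]; first exact: add_continuous.
  have Uk : U r s k j @[r --> s] --> U s s k j.
    have [Ud _] := is_derive_coord k j ((UB s).2 s).
    by apply: differentiable_continuous; exact/derivable1_diffP.
  exact: (cvg_norm (cvgB (cvg_cst ((1%:M : 'M[R]_n) k j)) Uk)).
apply/cvgrPdist_le => e e0.
move/cvgrPdist_le : H => /(_ e e0); apply: filterS => r.
rewrite sub0r normrN ger0_norm; last first.
  by rewrite mulr_ge0 ?expR_ge0// sumr_ge0.
apply: le_trans.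
pose x : 'cV[R]_n := delta_mx j 0.
have colj (M : 'M[R]_n) k : M k j = (M *m x) k 0 by rewrite -colE mxE.
have mxB (u v : 'cV[R]_n) k : (u - v) k 0 = u k 0 - v k 0 by rewrite !mxE.
have -> : (1%:M : 'M[R]_n) i j - U s r i j = - (U s r *m (x - U r s *m x)) i 0.
  by rewrite !colj mulmxBr mulmxA transition_cocycle (UB s).1 mxB opprB.
rewrite normrN; apply: (le_trans (coord_le_enorm _ _)).
apply: (le_trans (transition_bound _ _ _)).
rewrite ler_wpM2l ?expR_ge0//; apply: (le_trans (enorm_sum_le _)).
by apply: ler_sum => k _; rewrite mxB !colj mul1mx.
Qed.

Lemma transition_left_continuous (t s : R) i j : U t r i j @[r --> s] --> U t s i j.
Proof.
have -> : (fun r => U t r i j) = fun r => \sum_(k < n) U t s i k * U s r k j.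
  by apply/funext => r; rewrite -(transition_cocycle t s r) mxE.
have -> : U t s i j = \sum_(k < n) U t s i k * (1%:M : 'M[R]_n) k j.
  by rewrite -[in LHS](mulmx1 (U t s)) mxE.
apply: cvg_big => [|k _]; first exact: add_continuous.
by apply: cvgM; [exact: cvg_cst|exact: transition_left_continuous_id].
Qed.

(** By the cocycle identity, [U t (s + h) - U t s = - U t (s + h) (U (s + h) s - I)]; divide by [h]
    and use continuity in the second argument. *)
Lemma transition_left_primitive (a c t : R) :
  mx_primitive a c (fun s => U t s) (fun s => - (U t s *m B s)).
Proof.
move=> i j; split=> s _; last first.
  by apply: cvg_at_left_filter; exact: transition_left_continuous.
have q k : rder (fun r => U r s k j) s (B s k j).
  apply: is_derive_rder; apply: is_derive_coord.
  by have := (UB s).2 s; rewrite (UB s).1 mulmx1.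
have Uc k : U t (s + h) i k @[h --> (0 : R)^'+] --> U t s i k.
  apply: (@cvg_comp _ _ _ (fun h => s + h) (fun r => U t r i k) _ (nbhs s)).
    have h0 : h @[h --> (0 : R)^'+] --> (0 : R) by exact: cvg_within.
    by apply: (near_eq_cvg_to (cvgD (cvg_cst s) h0)); [rewrite addr0|near=> h].
  exact: transition_left_continuous.
have H : - (\sum_(k < n) U t (s + h) i k * (h^-1 * (U (s + h) s k j - U s s k j)))
    @[h --> (0 : R)^'+] --> - \sum_(k < n) U t s i k * B s k j.
  apply: cvgN; apply: cvg_big => [|k _]; first exact: add_continuous.
  by apply: cvgM; [exact: Uc|exact: q].
apply: (near_eq_cvg_to H); first by rewrite !mxE.
near=> h.
have -> : U t (s + h) i j = \sum_(k < n) U t (s + h) i k * U s s k j.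
  by rewrite (UB s).1 -[in LHS](mulmx1 (U t (s + h))) mxE.
have -> : U t s i j = \sum_(k < n) U t (s + h) i k * U (s + h) s k j.
  by rewrite -(transition_cocycle t (s + h) s) mxE.
rewrite -sumrB mulr_sumr -sumrN; apply: eq_bigr => k _ /=; ring.
Unshelve. all: by end_near. Qed.

(** The variation of constants formula before integration, in the form to which [enorm_comparison]
    applies; at [s = t] the function equals [z t]. *)
Lemma variation_of_constants (a c t : R) (z g : R -> 'cV[R]_n) :
  mx_primitive a c z (fun s => B s *m z s + g s) ->
  mx_primitive a c (fun s => U t s *m z s) (fun s => U t s *m g s).
Proof.
move=> zg; apply: mx_primitive_eq
  (mx_primitive_mul (transition_left_primitive a c t) zg) => // s _.
by rewrite mulmxDr mulNmx mulmxA addKr.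
Qed.

End TransitionMatrix.

(** * Solutions of equations with piecewise constant argument *)

Section Solutions.
Variables (R : realType) (th : int -> R) (theta : R) (beta : R -> R).
Hypotheses (sw : switching_sequence th theta) (ba : argument_function th beta).

Lemma switching_le (i j : int) : i <= j -> th i <= th j.
Proof.
by rewrite le_eqVlt => /predU1P[->//|ij]; case: sw => h _ _; exact/ltW/h.
Qed.

Lemma switching_lt_inv (i j : int) (t : R) : th i <= t -> t < th j -> i < j.
Proof.
move=> it tj; rewrite ltNge; apply/negP => /switching_le ji.
by have := lt_le_trans tj (le_trans ji it); rewrite ltxx.
Qed.

Lemma switching_locate (t : R) : exists i : int, th i <= t < th (i + 1).
Proof.
case: (sw) => inc unb _.
have [N HN] := unb (`|t| + `|th 0| + 1).
have t1 := ler_norm t; have t2 : - `|t| <= t by rewrite lerNl -normrN ler_norm.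
have n1 := ler_norm (th 0).
have n2 : - `|th 0| <= th 0 by rewrite lerNl -normrN ler_norm.
have t0 := normr_ge0 t; have n0 := normr_ge0 (th 0).
(* By monotonicity [th (- N)] is at most [th 0], so its large absolute value can only mean that it
   is very negative; symmetrically for [th N] below. *)
have lo : th (- (N%:Z)) <= t.
  have := HN (- (N%:Z)); rewrite abszN absz_nat leqnn => /(_ isT).
  have : th (- (N%:Z)) <= th 0 by apply: switching_le; rewrite oppr_le0.
  by move: (th (- (N%:Z))) => y; rewrite ler_normr => h /orP[]; lra.
have hi : t < th N%:Z.
  have := HN N%:Z; rewrite absz_nat leqnn => /(_ isT).
  have : th 0 <= th N%:Z by exact: switching_le.
  by move: (th N%:Z) => y; rewrite ler_normr => h /orP[]; lra.
have ex : exists n : nat, t < th (- (N%:Z) + n%:Z).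
  by exists (N + N)%N; rewrite PoszD addKr.
(* The least [n] with [t < th (- N + n)] marks the right end of the interval; it is not 0, since
   [th (- N) <= t]. *)
case: (ex_minnP ex) => -[|n] tn minn.
  by move: tn; rewrite addr0 ltNge lo.
exists (- (N%:Z) + n%:Z); rewrite -addrA -PoszD addn1 tn andbT.
by rewrite leNgt; apply/negP => /minn; rewrite ltnn.
Qed.

Lemma solution_onW n rhs (D E : set R) (z : R -> 'cV[R]_n) : E `<=` D ->
  solution_on th beta rhs D z -> solution_on th beta rhs E z.
Proof.
move=> ED [zc zd zr]; split.
- exact: continuous_subspaceW zc.
- by move=> i t /ED; exact: zd.
- by move=> i /ED; exact: zr.
Qed.

Lemma solution_on_later n rhs (i j : int) (z : R -> 'cV[R]_n) : i <= j ->
  solution_on th beta rhs `[th i, +oo[ z -> solution_on th beta rhs `[th j, +oo[ z.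
Proof.
move=> ij; apply: solution_onW => t /=; rewrite !in_itv/= !andbT.
exact/le_trans/switching_le.
Qed.

(** Merges the two differential conditions of a solution into one valid across switching points, so
    that later estimates need not be split there. *)
Lemma solution_primitive n rhs (i : int) (a c : R) (z : R -> 'cV[R]_n) :
  th i <= a -> solution_on th beta rhs `[th i, +oo[ z ->
  mx_primitive a c z (fun t => rhs t (z t) (z (beta t))).
Proof.
move=> ia [zc zd zr] k j; rewrite ord1; split=> t /andP[t1 t2]; last first.
  apply: cvg_at_left_filter.
  have czk : {within `[th i, +oo[, continuous (fun t => z t k 0)}.
    by move=> x; exact: (cvg_comp _ _ (zc x) (@coord_continuous _ n 1 k 0 (z x))).
  have /continuous_within_itvcyP[+ _] := czk.
  by apply; rewrite in_itv/= andbT (le_lt_trans ia).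
have [j' /andP[j1 j2]] := switching_locate t.
(* The switching point preceding [t] lies in the half-line, as the derivative conditions of
   [solution_on] require. *)
have ij' : th i <= th j'.
  apply: switching_le; rewrite -ltzD1.
  exact: switching_lt_inv (le_trans ia t1) j2.
have Dj' : `[th i, +oo[%classic (th j') by rewrite /= in_itv/= andbT.
move: j1; rewrite le_eqVlt => /predU1P[<-|j1].
  exact/right_derivative_coord/zr.
apply: is_derive_rder; apply: is_derive_coord; apply: zd Dj' _.
by rewrite j1.
Qed.

(** Compactness of the interval; this will carry a bound valid from some time on back to an earlier
    switching point. *)
Lemma solution_bounded_on n rhs (i : int) (c : R) (z : R -> 'cV[R]_n) :
  solution_on th beta rhs `[th i, +oo[ z ->
  exists D, forall t, th i <= t <= c -> enorm (z t) <= D.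
Proof.
move=> [zc _ _]; have [ic|ci] := leP (th i) c; last first.
  by exists 0 => t /andP[it /(le_trans it)]; rewrite leNgt ci.
have zc' : {within `[th i, c], continuous z}.
  apply: continuous_subspaceW zc => t /=; rewrite !in_itv/= andbT.
  by move=> /andP[].
have zn : {within `[th i, c], continuous (fun t => enorm (z t))}.
  move=> x; apply: (@continuous_cvg _ _ _ _ _ (fun t => \sum_(k < n) z t k 0 ^+ 2)).
  - exact: nbhs_subspace_filter.
  - exact: sqrt_continuous.
  apply: cvg_big => [|  |k _]; first exact: add_continuous.
    exact: nbhs_subspace_filter.
  have zk := cvg_comp _ _ (zc' x) (@coord_continuous _ n 1 k 0 (z x)).
  exact: (cvgM zk zk).
have [e _ H] := EVT_max ic zn.
by exists (enorm (z e)) => t tic; apply: H; rewrite in_itv.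
Qed.

End Solutions.

(** * The reduced system *)

Section ReducedSystem.
Variables (R : realType) (k p : nat) (th : int -> R) (theta : R) (beta : R -> R).
Variables (A : R -> 'M[R]_(k + p)) (mu : R).
Variables (f : R -> 'cV[R]_(k + p) -> 'cV[R]_(k + p) -> 'cV[R]_(k + p)) (l : R).
Variables (Q : R -> 'M[R]_(k + p)) (Bp : R -> 'M[R]_k) (Bm : R -> 'M[R]_p) (c L : R).

Hypotheses (sw : switching_sequence th theta) (ba : argument_function th beta).
Hypotheses (theta_gt0 : 0 < theta) (mu_ge0 : 0 <= mu) (l_ge0 : 0 <= l).
Hypothesis A_mu : forall t x, enorm (A t *m x) <= mu * enorm x.
Hypothesis f_lip : forall t y1 y2 w1 w2,
  enorm (f t y1 w1 - f t y2 w2) <= l * (enorm (y1 - y2) + enorm (w1 - w2)).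
Hypothesis l_small :
  l * expR (mu * theta) * theta *
    (1 + expR (mu * theta) * (1 + l * theta) * expR (expR (mu * theta) * l * theta))
  < expR (- (mu * theta)).
Hypotheses (Q_diff : forall t, derivable Q t 1) (Q_unit : forall t, Q t \in unitmx).
Hypothesis c_gt0 : 0 < c.
Hypothesis Q_c : forall t x, enorm (Q t *m x) <= c * enorm x.
Hypothesis dQ_c : forall t x, enorm (derive1 Q t *m x) <= c * enorm x.
Hypothesis iQ_c : forall t x, enorm (invmx (Q t) *m x) <= c * enorm x.
Hypothesis Q_block : forall t,
  invmx (Q t) *m A t *m Q t - invmx (Q t) *m derive1 Q t = block_mx (Bp t) 0 0 (Bm t).
Hypothesis L_ge0 : 0 <= L.

Let gp := g_plus f beta Q.
Let gm := g_minus f beta Q.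
Let rhs := reduced_rhs Bp Bm gp gm.

Hypothesis g_lip : forall t z1 z2 w1 w2,
  enorm (gp t z1 w1 - gp t z2 w2) + enorm (gm t z1 w1 - gm t z2 w2)
  <= L * (enorm (z1 - z2) + enorm (w1 - w2)).

Let sol (i : int) := solution_on th beta rhs `[th i, +oo[.
(** Bounds [Q^-1 A Q - Q^-1 Q'], and hence each diagonal block. *)
Let b : R := c * mu * c + c * c.

Lemma block_bound_ge0 : 0 <= b.
Proof. by rewrite addr_ge0 ?mulr_ge0 ?(ltW c_gt0). Qed.

Lemma block_bound t x : enorm (block_mx (Bp t) 0 0 (Bm t) *m x) <= b * enorm x.
Proof.
rewrite -Q_block mulmxBl; apply: le_trans (enormD _ _) _.
rewrite enormN mulrDl; apply: lerD.
  rewrite -!mulmxA; apply: le_trans (iQ_c _ _) _; rewrite -!mulrA ler_pM2l//.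
  apply: le_trans (A_mu _ _) _; rewrite ler_wpM2l//.
rewrite -!mulmxA; apply: le_trans (iQ_c _ _) _; rewrite -!mulrA ler_pM2l//.
Qed.

Lemma Bp_bound t x : enorm (Bp t *m x) <= b * enorm x.
Proof.
have := block_bound t (col_mx x 0); rewrite mul_block_col !mulmx0 !mul0mx !addr0.
have en (y : 'cV[R]_k) : enorm (col_mx y (0 : 'cV[R]_p)) = enorm y.
  apply/eqP; rewrite -(eqrXn2 (ltn0Sn 1)) ?enorm_ge0//.
  by rewrite enorm_col_mx enorm0 expr0n addr0.
by rewrite !en.
Qed.

Lemma Bm_bound t x : enorm (Bm t *m x) <= b * enorm x.
Proof.
have := block_bound t (col_mx 0 x); rewrite mul_block_col !mulmx0 !mul0mx !add0r.
have en (y : 'cV[R]_p) : enorm (col_mx (0 : 'cV[R]_k) y) = enorm y.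
  apply/eqP; rewrite -(eqrXn2 (ltn0Sn 1)) ?enorm_ge0//.
  by rewrite enorm_col_mx enorm0 expr0n add0r.
by rewrite !en.
Qed.

Lemma reduced_rhsE t z w :
  rhs t z w = block_mx (Bp t) 0 0 (Bm t) *m z +
              invmx (Q t) *m f t (Q t *m z) (Q (beta t) *m w).
Proof.
rewrite -{2}(vsubmxK z) mul_block_col !mul0mx addr0 add0r.
by rewrite -[invmx _ *m _]/(reduced_g f beta Q t z w) -[reduced_g _ _ _ _ _ _]vsubmxK add_col_mx.
Qed.

(** Undoes the substitution [y = Q z]: the terms with [Q'] cancel. In these coordinates the
    constants are [mu] and [l], those of the smallness condition. *)
Lemma original_primitive (i : int) (a e : R) z w : sol i z -> sol i w -> th i <= a ->
  mx_primitive a e (fun t => Q t *m (z t - w t))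
    (fun t => A t *m (Q t *m (z t - w t)) +
      (f t (Q t *m z t) (Q (beta t) *m z (beta t)) -
       f t (Q t *m w t) (Q (beta t) *m w (beta t)))).
Proof.
move=> zs ws ia.
have Qp : mx_primitive a e Q (derive1 Q).
  apply: mx_primitive_deriv => t; rewrite derive1E; exact/derivableP/Q_diff.
have H := mx_primitive_mul Qp
  (mx_primitiveB (solution_primitive sw e ia zs) (solution_primitive sw e ia ws)).
apply: mx_primitive_eq H => [//|t _].
rewrite !reduced_rhsE -Q_block.
set F1 := f t _ _; set F2 := f t _ _; set B := _ - _ *m derive1 Q t.
have -> : B *m z t + invmx (Q t) *m F1 - (B *m w t + invmx (Q t) *m F2) =
    invmx (Q t) *m (A t *m (Q t *m (z t - w t)) - derive1 Q t *m (z t - w t) + (F1 - F2)).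
  rewrite opprD addrACA -[in LHS]mulmxBr -[in LHS]mulmxBr [in RHS]mulmxDr; congr (_ + _).
  by move: (z t - w t) => d; rewrite /B mulmxBl mulmxBr !mulmxA.
by rewrite mulKVmx// addrA subrKC.
Qed.

(** * Two-sided estimates on a switching interval *)

Lemma switching_interval_bound (j : int) t : th j <= t <= th (j + 1) ->
  0 <= t - th j <= theta.
Proof.
case: sw => _ _ /(_ j) h /andP[t1 t2]; rewrite subr_ge0 t1/=.
by apply: le_trans h; rewrite lerD2r.
Qed.

(* Backward control over a whole switching interval, where the equation contains
   the value at the left end: this is what the smallness of [l] is for. *)
Lemma original_two_sided : exists C : R, 0 < C /\
  forall (j : int) z w t, sol j z -> sol j w -> th j <= t <= th (j + 1) ->
    enorm (Q t *m (z t - w t)) <= C * enorm (Q (th j) *m (z (th j) - w (th j))) /\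
    enorm (Q (th j) *m (z (th j) - w (th j))) <= C * enorm (Q t *m (z t - w t)).
Proof.
have := l_small; set M := expR (mu * theta).
(* [S] is the forward growth factor over one interval; [r] is the share of the initial difference
   that the backward estimate returns, to be absorbed on the left since [r < 1]. *)
set S := M * (1 + l * theta) * expR (M * l * theta).
set r := l * M * theta * (1 + S) => rm.
have M1 : 1 <= M by rewrite -expR0 ler_expR mulr_ge0// ltW.
have lt0 : 0 <= l * theta by rewrite mulr_ge0// ltW.
have S0 : 0 < S.
  by rewrite !mulr_gt0 ?expR_gt0// ltr_pwDl.
have r1 : r < 1.
  apply: lt_le_trans rm _; rewrite -expR0 ler_expR oppr_le0 mulr_ge0//.
  exact: ltW.
exists (S + M / (1 - r)); split.
  by rewrite addr_gt0// divr_gt0 ?subr_gt0 ?expR_gt0.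
move=> j z w t zs ws tj; have /andP[t1 t2] := tj.
have /andP[h0 h1] := switching_interval_bound tj.
set e := fun t => Q t *m (z t - w t).
have betaj s : th j <= s < t -> beta s = th j.
  by move=> /andP[s1 s2]; apply: ba; rewrite s1 (lt_le_trans s2).
have ep := original_primitive t zs ws (lexx (th j)).
have fb s : th j <= s < t ->
    enorm (f s (Q s *m z s) (Q (beta s) *m z (beta s)) -
           f s (Q s *m w s) (Q (beta s) *m w (beta s))) <=
    l * (enorm (e s) + enorm (e (th j))).
  move=> sj; apply: le_trans (f_lip _ _ _ _ _) _.
  by rewrite betaj// -!mulmxBr.
have ed s : th j <= s < t -> enorm (A s *m e s + (f s (Q s *m z s) (Q (beta s) *m z (beta s)) -
           f s (Q s *m w s) (Q (beta s) *m w (beta s)))) <=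
     mu * enorm (e s) + l * (enorm (e s) + enorm (e (th j))).
  by move=> sj; apply: le_trans (enormD _ _) _; apply: lerD (A_mu _ _) (fb s sj).
have a0 : 0 <= enorm (e (th j)) by exact: enorm_ge0.
have up s : th j <= s <= t -> enorm (e s) <= S * enorm (e (th j)).
  move=> /andP[s1 s2].
  have sj : 0 <= s - th j <= theta.
    by apply: switching_interval_bound; rewrite s1 (le_trans s2).
  have /andP[sj0 sj1] := sj.
  have [q /andP[q1 q2]|H _] := enorm_gronwall s1 (addr_ge0 mu_ge0 l_ge0)
      (mulr_ge0 l_ge0 a0) (mx_primitiveW (lexx _) s2 ep).
    apply: le_trans (ed q _) _; first by rewrite q1 (lt_le_trans q2).
    by rewrite le_eqVlt; apply/orP; left; apply/eqP; rewrite /e; ring.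
  apply: le_trans H _.
  have -> : enorm (e (th j)) + l * enorm (e (th j)) * (s - th j) =
    (1 + l * (s - th j)) * enorm (e (th j)) by ring.
  rewrite mulrA ler_wpM2r// /S mulrAC; apply: ler_pM.
  - by rewrite ltW// expR_gt0.
  - by rewrite addr_ge0// mulr_ge0.
  - rewrite mulrDl expRD ler_pM ?expR_ge0//.
      by rewrite ler_expR ler_wpM2l.
    rewrite ler_expR -mulrA; apply: le_trans (_ : l * theta <= _).
      by rewrite ler_wpM2l.
    by rewrite ler_peMl.
  - by rewrite lerD2l ler_wpM2l.
split.
  apply: le_trans (up t _) _; first by rewrite t1 lexx.
  rewrite ler_wpM2r// lerDl divr_ge0 ?expR_ge0//.
  by rewrite subr_ge0 ltW.
(* For the backward estimate the whole contribution of [f] is treated as a constant forcing, bounded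
   by means of [up]. *)
have k0 : 0 <= l * (1 + S) * enorm (e (th j)).
  by rewrite !mulr_ge0// addr_ge0// ltW.
have [s sj|_ H] := enorm_gronwall t1 mu_ge0 k0 ep.
  apply: le_trans (ed s sj) _; rewrite lerD2l -mulrA ler_wpM2l//.
  rewrite mulrDl mul1r addrC lerD2l; apply: up.
  by have /andP[-> /ltW ->] := sj.
have {H} : enorm (e (th j)) <= M * enorm (e t) + r * enorm (e (th j)).
  apply: le_trans H _.
  have E1 : expR (mu * (t - th j)) <= M by rewrite ler_expR ler_wpM2l.
  apply: le_trans (_ : M * (enorm (e t) + l * (1 + S) * enorm (e (th j)) * theta) <= _).
    apply: ler_pM E1 _.
    - exact: expR_ge0.
    - by rewrite addr_ge0 ?enorm_ge0// mulr_ge0.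
    - by rewrite lerD2l ler_wpM2l.
  by rewrite le_eqVlt; apply/orP; left; apply/eqP; rewrite /r; ring.
rewrite -lerBlDr => {}H.
have r10 : 0 < 1 - r by rewrite subr_gt0.
have : enorm (e (th j)) <= M / (1 - r) * enorm (e t).
  rewrite mulrAC ler_pdivlMr//; apply: le_trans H.
  by rewrite le_eqVlt; apply/orP; left; apply/eqP; ring.
move/le_trans; apply; rewrite ler_wpM2r ?enorm_ge0//.
by rewrite lerDr ltW.
Qed.

Lemma reduced_two_sided : exists C : R, 0 < C /\
  forall (j : int) z w t, sol j z -> sol j w -> th j <= t <= th (j + 1) ->
    enorm (z t - w t) <= C * enorm (z (th j) - w (th j)) /\
    enorm (z (th j) - w (th j)) <= C * enorm (z t - w t).
Proof.
have [C [C0 HC]] := original_two_sided.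
have key t s (x y : 'cV[R]_(k + p)) : enorm (Q t *m x) <= C * enorm (Q s *m y) ->
    enorm x <= c * C * c * enorm y.
  move=> h; rewrite -{1}(mul1mx x) -(mulVmx (Q_unit t)) -mulmxA.
  apply: le_trans (iQ_c _ _) _; rewrite -!mulrA ler_pM2l//.
  by apply: le_trans h _; rewrite ler_pM2l.
exists (c * C * c); split; first by rewrite !mulr_gt0.
move=> j z w t zs ws tj; have [h1 h2] := HC j z w t zs ws tj.
by split; [exact: key h1|exact: key h2].
Qed.

(** Agreement goes back from [t0] to [th j], then forward from one switching point to the next. The
    right end [t0 = th (j + 1)] is included so that uniqueness can also be propagated to earlier
    intervals. *)
Lemma solution_unique_from (j : int) z w t0 : sol j z -> sol j w ->
  th j <= t0 <= th (j + 1) -> z t0 = w t0 -> forall t, th j <= t -> z t = w t.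
Proof.
move=> zs ws tj zw0; have [C [C0 HC]] := reduced_two_sided.
have eq0 x y : enorm (z x - w x) <= C * enorm (z y - w y) -> z y = w y -> z x = w x.
  move=> h zwy; apply/eqP; rewrite -subr_eq0; apply/eqP/enorm_le0.
  by rewrite (le_trans h)// zwy subrr enorm0 mulr0.
have later (m : nat) : sol (j + m%:Z) z /\ sol (j + m%:Z) w.
  have jm : j <= j + m%:Z by rewrite lerDl.
  by split; [exact: (solution_on_later sw jm zs)|exact: (solution_on_later sw jm ws)].
have steps (m : nat) : z (th (j + m%:Z)) = w (th (j + m%:Z)).
  elim: m => [|m IH].
    by rewrite addr0; apply: eq0 zw0; have [] := HC j z w t0 zs ws tj.
  have [zm wm] := later m; apply: eq0 IH.
  have -> : j + m.+1%:Z = j + m%:Z + 1 by rewrite -addrA -PoszD addn1.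
  apply: (HC _ _ _ _ zm wm _).1; rewrite lexx andbT.
  by apply: (switching_le sw); rewrite lerDl.
move=> t jt; have [i /andP[i1 i2]] := switching_locate sw t.
have ji : j <= i by rewrite -ltzD1; exact: (switching_lt_inv sw jt i2).
have [m im] : exists m : nat, i = j + m%:Z.
  by exists `|i - j|%N; rewrite gez0_abs ?subr_ge0// subrKC.
have [zm wm] := later m; apply: eq0 (steps m).
by apply: (HC _ _ _ _ zm wm _).1; rewrite -im i1 ltW.
Qed.

Lemma solution_unique z w (j : int) :
  solution_on th beta rhs setT z -> solution_on th beta rhs setT w ->
  z (th j) = w (th j) -> z = w.
Proof.
move=> zs ws zwj.
have solT i y : solution_on th beta rhs setT y -> sol i y by exact: solution_onW.
have steps (m : nat) : z (th (j - m%:Z)) = w (th (j - m%:Z)).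
  elim: m => [|m IH]; first by rewrite subr0.
  (* One interval backward: the known common value sits at its right end. *)
  apply: (@solution_unique_from (j - m.+1%:Z) z w (th (j - m%:Z))) => //; try exact: solT.
  have -> : j - m%:Z = j - m.+1%:Z + 1 by rewrite -addn1 PoszD opprD addrA subrK.
  by rewrite lexx andbT; apply: (switching_le sw); rewrite lerDl.
apply/funext => t; have [i /andP[i1 i2]] := switching_locate sw t.
have [ij|/ltW ji] := leP i j.
  have [m im] : exists m : nat, i = j - m%:Z.
    by exists `|j - i|%N; rewrite gez0_abs ?subr_ge0// opprB subrKC.
  apply: (@solution_unique_from i z w (th i)) => //; try exact: solT.
    by rewrite lexx; apply: (switching_le sw); rewrite lerDl.
  by rewrite im.
apply: (@solution_unique_from j z w (th j)) => //; try exact: solT.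
  by rewrite lexx; apply: (switching_le sw); rewrite lerDl.
exact: le_trans (switching_le sw ji) i1.
Qed.

(** * Equations for the stable and unstable components of a difference *)

Lemma stable_part_primitive (i : int) (a e : R) z w : sol i z -> sol i w -> th i <= a ->
  mx_primitive a e (fun t => usubmx (z t - w t))
    (fun t => Bp t *m usubmx (z t - w t) +
      (gp t (z t) (z (beta t)) - gp t (w t) (w (beta t)))).
Proof.
move=> zs ws ia.
have H := mx_primitive_usubmx
  (mx_primitiveB (solution_primitive sw e ia zs) (solution_primitive sw e ia ws)).
apply: mx_primitive_eq H => [//|t _].
by rewrite /rhs /reduced_rhs !linearB/= !col_mxKu opprD addrACA.
Qed.

Lemma unstable_part_primitive (i : int) (a e : R) z w : sol i z -> sol i w -> th i <= a ->
  mx_primitive a e (fun t => dsubmx (z t - w t))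
    (fun t => Bm t *m dsubmx (z t - w t) +
      (gm t (z t) (z (beta t)) - gm t (w t) (w (beta t)))).
Proof.
move=> zs ws ia.
have H := mx_primitive_dsubmx
  (mx_primitiveB (solution_primitive sw e ia zs) (solution_primitive sw e ia ws)).
apply: mx_primitive_eq H => [//|t _].
by rewrite /rhs /reduced_rhs !linearB/= !col_mxKd opprD addrACA.
Qed.

Lemma gp_lip t z1 z2 w1 w2 :
  enorm (gp t z1 w1 - gp t z2 w2) <= L * (enorm (z1 - z2) + enorm (w1 - w2)).
Proof. by apply: le_trans (g_lip t z1 z2 w1 w2); rewrite lerDl enorm_ge0. Qed.

Lemma gm_lip t z1 z2 w1 w2 :
  enorm (gm t z1 w1 - gm t z2 w2) <= L * (enorm (z1 - z2) + enorm (w1 - w2)).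
Proof. by apply: le_trans (g_lip t z1 z2 w1 w2); rewrite lerDr enorm_ge0. Qed.

(** Inside one interval the values of the difference at [s] and at [beta s = th j] are both
    controlled by its value at [th j], and therefore so is the derivative of its stable
    component. *)
Lemma stable_part_increment : exists C : R, 0 <= C /\
  forall (j : int) z w t t', sol j z -> sol j w ->
    th j <= t -> t <= t' -> t' <= th (j + 1) ->
    enorm (usubmx (z t' - w t') - usubmx (z t - w t)) <=
    C * (t' - t) * enorm (z (th j) - w (th j)).
Proof.
have [C [C0 HC]] := reduced_two_sided.
have b0 : 0 <= b := block_bound_ge0.
have C1 : 0 <= C + 1 by rewrite addr_ge0// ltW.
exists (b * C + L * (C + 1)); split.
  by apply: addr_ge0; [exact/mulr_ge0/ltW|exact: mulr_ge0].
move=> j z w t t' zs ws jt tt' t'j.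
set a := z (th j) - w (th j).
pose kap := (b * C + L * (C + 1)) * enorm a.
have zP := mx_primitiveB (stable_part_primitive t' zs ws jt)
  (mx_primitive_cst t t' (usubmx (z t - w t))).
have [s /andP[s1 s2]|+ _] := enorm_comparison tt' zP
    (right_primitive_deriv t t' (is_derive_linear kap t)).
  have sj : th j <= s <= th (j + 1).
    by rewrite (le_trans jt)//= ltW// (lt_le_trans s2).
  have bs : beta s = th j.
    by apply: ba; rewrite (le_trans jt)//= (lt_le_trans s2).
  have ds : enorm (z s - w s) <= C * enorm a by have [] := HC j z w s zs ws sj.
  rewrite subr0; apply: le_trans (enormD _ _) _; rewrite /kap mulrDl; apply: lerD.
    apply: le_trans (Bp_bound _ _) _; rewrite -/b -mulrA ler_wpM2l//.
    exact: le_trans (enorm_usubmx _) ds.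
  apply: le_trans (gp_lip _ _ _ _ _) _; rewrite -mulrA ler_wpM2l//.
  by rewrite bs mulrDl mul1r lerD2r.
by rewrite !subrr enorm0 add0r mulr0 subr0 /kap mulrAC.
Qed.

(** * Consequences of the dichotomy for solutions bounded to the right *)

Section Dichotomy.
Variables (K sigma : R) (U : R -> R -> 'M[R]_k) (V : R -> R -> 'M[R]_p).
Hypotheses (K_gt0 : 0 < K) (sigma_gt0 : 0 < sigma).
Hypotheses (UB : transition_matrix Bp U) (VB : transition_matrix Bm V).
Hypothesis U_decay : forall t s x, s <= t ->
  enorm (U t s *m x) <= K * expR (- sigma * (t - s)) * enorm x.
Hypothesis V_decay : forall t s x, t <= s ->
  enorm (V t s *m x) <= K * expR (- sigma * (s - t)) * enorm x.
Hypothesis L_small : L <= sigma / (8 * K).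

Lemma beta_ge (j : int) s : th j <= s -> th j <= beta s.
Proof.
move=> js; have [i /andP[i1 i2]] := switching_locate sw s.
rewrite (ba (i := i)) ?i1//; apply: (switching_le sw); rewrite -ltzD1.
exact: (switching_lt_inv sw js i2).
Qed.

(* The right-hand sides only involve values after [th j], because [th j] is a
   switching point: the usual contraction argument applies. *)
Lemma bounded_difference_halved (j : int) z w (D : R) : sol j z -> sol j w ->
  usubmx (z (th j) - w (th j)) = 0 ->
  (forall t, th j <= t -> enorm (z t - w t) <= D) ->
  forall t, th j <= t -> enorm (z t - w t) <= D / 2.
Proof.
move=> zs ws u0 HD t jt; have b0 : 0 <= b := block_bound_ge0.
have D0 : 0 <= D by apply: le_trans (HD _ jt); exact: enorm_ge0.
have gpD s : th j <= s ->
    enorm (gp s (z s) (z (beta s)) - gp s (w s) (w (beta s))) <= 2 * L * D.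
  move=> js; apply: le_trans (gp_lip _ _ _ _ _) _.
  rewrite [2 * L]mulrC -mulrA ler_wpM2l// mulr_natl mulr2n.
  by apply: lerD; apply: HD => //; exact: beta_ge.
have gmD s : th j <= s ->
    enorm (gm s (z s) (z (beta s)) - gm s (w s) (w (beta s))) <= 2 * L * D.
  move=> js; apply: le_trans (gm_lip _ _ _ _ _) _.
  rewrite [2 * L]mulrC -mulrA ler_wpM2l// mulr_natl mulr2n.
  by apply: lerD; apply: HD => //; exact: beta_ge.
(* The integral of [K expR (- sigma r)] over [r >= 0], times the bound [2 L D] of the nonlinear
   terms. The bound on [L] makes it at most [D / 4], and each of the two components contributes one
   [q]. *)
pose q := 2 * K * L * D / sigma.
have q0 : 0 <= q by rewrite /q divr_ge0 ?mulr_ge0 ?(ltW K_gt0) ?(ltW sigma_gt0).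
have qs : q * sigma = K * (2 * L * D) by rewrite /q divfK ?gt_eqF//; ring.
have q4 : q <= D / 4.
  rewrite /q ler_pdivrMr//.
  have : L * (8 * K) <= sigma by rewrite -ler_pdivlMr ?mulr_gt0.
  move/(ler_wpM2r D0); lra.
have Hu : enorm (usubmx (z t - w t)) <= q.
  have zP := variation_of_constants b0 Bp_bound UB t
    (stable_part_primitive t zs ws (lexx _)).
  (* The derivative of [q expR (sigma (s - t))] in [s] is exactly the bound on the integrand. *)
  have pP := right_primitiveZ q (right_primitive_deriv (th j) t
    (is_derive_expR_linear sigma t)).
  have [s /andP[s1 s2]|+ _] := enorm_comparison jt zP pP.
    apply: le_trans (U_decay _ (ltW s2)) _.
    rewrite mulNr -mulrN opprB [q * _]mulrA qs mulrAC.
    apply: ler_wpM2r; first exact: expR_ge0.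
    by rewrite ler_pM2l// gpD.
  rewrite (UB t).1 mul1mx u0 mulmx0 enorm0 add0r subrr mulr0 expR0 mulr1.
  move/le_trans; apply; rewrite gerBl mulr_ge0// expR_ge0.
have Hv : enorm (dsubmx (z t - w t)) <= q.
  apply/ler_addgt0Pr => e e0.
  (* The unstable component is integrated backward from [T], where only the bound [D] is known. Here
     [sigma * (T - t) = K * D / e], so [1 + x <= expR x] makes the boundary term at most [e]. *)
  pose T := t + K * D / (e * sigma).
  have KD0 : 0 <= K * D by rewrite mulr_ge0// ltW.
  have tT : t <= T by rewrite lerDl divr_ge0// ltW// mulr_gt0.
  have zP := variation_of_constants b0 Bm_bound VB t
    (unstable_part_primitive T zs ws jt).
  have pP := right_primitiveZ (- q) (right_primitive_deriv t T
    (is_derive_expR_linear (- sigma) t)).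
  have [s /andP[s1 s2]|_ +] := enorm_comparison tT zP pP.
    apply: le_trans (V_decay _ s1) _.
    rewrite [- q * _]mulrA mulrNN qs mulrAC; apply: ler_wpM2r; first exact: expR_ge0.
    by rewrite ler_pM2l// gmD// (le_trans jt).
  rewrite (VB t).1 mul1mx subrr mulr0 expR0 mulr1 opprK.
  move/le_trans; apply; rewrite addrC; apply: lerD.
    by rewrite gerDr mulNr oppr_le0 mulr_ge0// expR_ge0.
  apply: le_trans (V_decay _ tT) _.
  apply: le_trans (_ : K * expR (- sigma * (T - t)) * D <= _).
    apply: ler_wpM2l; first by rewrite mulr_ge0 ?expR_ge0// ltW.
    apply: le_trans (enorm_dsubmx _) _; apply: HD; exact: le_trans jt tT.
  rewrite mulrAC mulNr expRN ler_pdivrMr ?expR_gt0//.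
  have -> : sigma * (T - t) = K * D / e.
    by rewrite /T addrAC subrr add0r; field; rewrite !gt_eqF.
  apply: le_trans (_ : e * (1 + K * D / e) <= _).
    by rewrite mulrDr mulr1 mulrCA divff ?gt_eqF// mulr1 lerDr ltW.
  by rewrite ler_pM2l// expR_ge1Dx.
apply: le_trans (enorm_le_split _) _; apply: le_trans (lerD Hu Hv) _.
by move: q4; lra.
Qed.

(** The set of bounds for the difference is closed under halving, so its infimum is 0. *)
Lemma bounded_solutions_agree (j : int) z w (D : R) : sol j z -> sol j w ->
  usubmx (z (th j) - w (th j)) = 0 ->
  (forall t, th j <= t -> enorm (z t - w t) <= D) -> z (th j) = w (th j).
Proof.
move=> zs ws u0 HD.
pose S := [set D | forall t, th j <= t -> enorm (z t - w t) <= D].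
have SD : S !=set0 by exists D.
have S0 : lbound S 0 by move=> E /(_ _ (lexx _)); apply: le_trans; exact: enorm_ge0.
have iS : inf S <= 0.
  have : 2 * inf S <= inf S.
    apply: lb_le_inf => // E SE; rewrite mulrC -ler_pdivlMr//.
    apply: ge_inf; first by exists 0.
    exact: bounded_difference_halved SE.
  lra.
apply/eqP; rewrite -subr_eq0; apply/eqP/enorm_le0; apply: le_trans iS.
by apply: lb_le_inf => // E; apply.
Qed.

(** * Invariance of the graph of [F] *)

Variables (F : R -> 'cV[R]_k -> 'cV[R]_p) (lam : R).
Hypotheses (lam_ge0 : 0 <= lam)
  (F_lip : forall t u1 u2, enorm (F t u1 - F t u2) <= lam * enorm (u1 - u2)).
Hypothesis F_stable : forall t0 u0, exists z,
  [/\ solution_on th beta rhs setT z, z t0 = col_mx u0 (F t0 u0) &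
      exists D, forall t, t0 <= t -> enorm (z t) <= D].

Let forward_bounded (z : R -> 'cV[R]_(k + p)) :=
  forall j : int, exists D : R, forall t, th j <= t -> enorm (z t) <= D.

(** A bound from [t0] on gives one from any switching point on: the part before [t0] is compact. *)
Lemma solution_forward_bounded t0 D z : solution_on th beta rhs setT z ->
  (forall t, t0 <= t -> enorm (z t) <= D) -> forward_bounded z.
Proof.
move=> zs zD j.
have zj : sol j z by exact: solution_onW zs.
have [E HE] := solution_bounded_on t0 zj.
exists (Num.max D E) => t jt; rewrite le_max; have [t0t|tt0] := leP t0 t.
  by rewrite zD.
by rewrite HE ?orbT// jt ltW.
Qed.

Lemma stable_solution_on_graph z : solution_on th beta rhs setT z -> forward_bounded z ->
  forall t, dsubmx (z t) = F t (usubmx (z t)).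
Proof.
have [C [C0 HC]] := reduced_two_sided.
have [C' [C'0 HC']] := stable_part_increment.
(* Chosen so that [C' h C (1 + lam) <= 1/2]; the summand 1 keeps the denominator positive. It
   depends neither on the solutions nor on the interval. *)
pose h := (2 * (C' * (C * (1 + lam)) + 1))^-1.
have h2 : 0 < 2 * (C' * (C * (1 + lam)) + 1).
  by rewrite mulr_gt0// ltr_wpDl// !mulr_ge0 ?addr_ge0// ltW.
have h0 : 0 < h by rewrite invr_gt0.
have hC : C' * h * (C * (1 + lam)) <= 2^-1.
  rewrite mulrAC /h ler_pdivrMr//.
  by rewrite mulKf ?lerDl// pnatr_eq0.
have solT i y : solution_on th beta rhs setT y -> sol i y by exact: solution_onW.
(* The comparison solution: it starts on the graph at time [t] above the same stable component as
   [y]. *)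
have companion y t : solution_on th beta rhs setT y -> exists w,
    [/\ solution_on th beta rhs setT w, forward_bounded w,
        usubmx (y t - w t) = 0 & dsubmx (w t) = F t (usubmx (y t))].
  move=> ys; have [w [ws wt [D wD]]] := F_stable t (usubmx (y t)).
  exists w; split => //; first exact: solution_forward_bounded wD.
    by rewrite linearB/= wt col_mxKu subrr.
  by rewrite wt col_mxKd.
have switching (j : int) y : solution_on th beta rhs setT y -> forward_bounded y ->
    dsubmx (y (th j)) = F (th j) (usubmx (y (th j))).
  move=> ys yb; have [w [ws wb u0 wF]] := companion y (th j) ys.
  have [D1 HD1] := yb j; have [D2 HD2] := wb j.
  have -> : dsubmx (y (th j)) = dsubmx (w (th j)); last by [].
  congr dsubmx; apply: (@bounded_solutions_agree j y w (D1 + D2)) => //; try exact: solT.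
  move=> t jt; apply: le_trans (enormD _ _) _; rewrite enormN.
  by apply: lerD; [exact: HD1|exact: HD2].
(* Induction on the number of steps of length [h] from [th j]. The claim covers all forward bounded
   solutions because it is applied at the earlier time to both [y] and its companion. *)
have steps (m : nat) (j : int) t : th j <= t <= th (j + 1) -> t <= th j + m%:R * h ->
    forall y, solution_on th beta rhs setT y -> forward_bounded y ->
    dsubmx (y t) = F t (usubmx (y t)).
  elim: m t => [|m IH] t /andP[jt tj] tm y ys yb.
    have -> : t = th j by apply/eqP; rewrite eq_le jt andbT; move: tm; rewrite mul0r addr0.
    exact: switching.
  have [w [ws wb u0 wF]] := companion y t ys.
  (* One step back, but not beyond the left end of the interval. *)
  pose s := Num.max (th j) (t - h).
  have js : th j <= s by rewrite le_max lexx.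
  have st : s <= t by rewrite ge_max jt gerBl ltW.
  have sj : th j <= s <= th (j + 1) by rewrite js (le_trans st).
  have ts : t - s <= h by rewrite lerBlDr -lerBlDl le_max lexx orbT.
  have sm : s <= th j + m%:R * h.
    rewrite ge_max lerDl mulr_ge0 ?(ltW h0)//= lerBlDr; apply: le_trans tm _.
    by rewrite -addrA lerD2l -natr1 mulrDl mul1r.
  set d := fun r => y r - w r.
  have dv : enorm (dsubmx (d s)) <= lam * enorm (usubmx (d s)).
    by rewrite /d !linearB/= (IH s sj sm y ys yb) (IH s sj sm w ws wb) F_lip.
  have ds : enorm (d s) <= (1 + lam) * enorm (usubmx (d s)).
    by apply: le_trans (enorm_le_split _) _; rewrite mulrDl mul1r lerD2l.
  have dj : enorm (d (th j)) <= C * enorm (d s).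
    by have [] := HC j y w s (solT _ _ ys) (solT _ _ ws) sj.
  have uj : enorm (usubmx (d s)) <= C' * h * enorm (d (th j)).
    have := HC' j y w s t (solT _ _ ys) (solT _ _ ws) js st tj.
    rewrite u0 sub0r enormN => /le_trans; apply.
    by rewrite ler_wpM2r ?enorm_ge0// ler_wpM2l.
  (* Closes the loop: [d_u s] is bounded by [d (th j)], that by [d s], and that by [d_u s] again,
     with total factor at most [1/2]. *)
  have us : enorm (usubmx (d s)) <= 2^-1 * enorm (usubmx (d s)).
    apply: le_trans (_ : C' * h * (C * (1 + lam)) * enorm (usubmx (d s)) <= _); last first.
      by rewrite ler_wpM2r ?enorm_ge0.
    apply: le_trans uj _; rewrite -!mulrA; apply: ler_wpM2l => //.
    apply: ler_wpM2l; first exact: ltW.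
    by apply: le_trans dj _; rewrite ler_pM2l.
  have us0 : enorm (usubmx (d s)) <= 0 by have := enorm_ge0 (usubmx (d s)); lra.
  have d0 : enorm (d s) <= 0.
    by apply: le_trans ds _; rewrite mulr_ge0_le0// addr_ge0.
  have zw : y s = w s by apply/eqP; rewrite -subr_eq0; apply/eqP/enorm_le0.
  have yw : y t = w t.
    exact: (solution_unique_from (solT j _ ys) (solT j _ ws) sj zw).
  by rewrite {1}yw wF.
move=> zs zb t; have [j /andP[jt tj]] := switching_locate sw t.
(* The integer part plus one gives enough steps to reach [t]. *)
have tm : t <= th j + (Num.truncn ((t - th j) / h)).+1%:R * h.
  by rewrite -lerBlDl -ler_pdivrMr// ltW// truncnS_gt.
by apply: (steps _ j t _ tm z) => //; rewrite jt ltW.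
Qed.

(** The solution [w] supplied by [F_stable] provides existence. Forward uniqueness identifies every
    [z] with [w] from [th i] on, uniqueness on the whole line identifies every continuation with
    [w], and [w], being forward bounded, stays on the graph. *)
Lemma stable_graph_integral : integral_set th beta rhs (graph_surface F).
Proof.
move=> i t0 z0 Sz0 /andP[it ti].
have [w [ws wt [D wD]]] := F_stable t0 (usubmx z0).
have wz0 : w t0 = z0 by rewrite wt -[RHS]vsubmxK; congr col_mx.
have solT y : solution_on th beta rhs setT y -> sol i y by exact: solution_onW.
split; first by exists w; split=> //; exact: solT.
move=> z [zs zt0].
have zw t : th i <= t -> w t = z t.
  move=> it'; apply: (@solution_unique_from i w z t0) => //.
  - exact: solT.
  - by rewrite it ltW.
  - by rewrite zt0.
split; first by exists w.
move=> zbar [bs bz] t.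
have -> : zbar = w.
  by apply: (@solution_unique _ _ i) => //; rewrite zw// bz.
apply: stable_solution_on_graph => //; exact: solution_forward_bounded wD.
Qed.

End Dichotomy.
End ReducedSystem.

(** * Choice of the threshold for [L] and passage from operator norms to vector estimates *)

Theorem theorem2p2 (R : realType) (K sigma theta eps alpha : R)
    (K_gt0 : 0 < K) (sigma_gt0 : 0 < sigma) (theta_gt0 : 0 < theta)
    (eps_gt0 : 0 < eps) (alpha_gt0 : 0 < alpha) (alpha_lt : alpha < sigma) :
  exists L0 : R, 0 < L0 /\
  forall (k p : nat)
    (th : int -> R) (beta : R -> R)
    (A : R -> 'M[R]_(k + p)) (mu : R)
    (f : R -> 'cV[R]_(k + p) -> 'cV[R]_(k + p) -> 'cV[R]_(k + p)) (l : R)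
    (X : R -> 'M[R]_(k + p)) (P : 'M[R]_(k + p))
    (Q : R -> 'M[R]_(k + p)) (Bp : R -> 'M[R]_k) (Bm : R -> 'M[R]_p)
    (U : R -> R -> 'M[R]_k) (V : R -> R -> 'M[R]_p)
    (L : R) (F : R -> 'cV[R]_k -> 'cV[R]_p),
  let M := expR (mu * theta) in
  let m := expR (- (mu * theta)) in
  let gp := g_plus f beta Q in
  let gm := g_minus f beta Q in
  let rhs := reduced_rhs Bp Bm gp gm in
  switching_sequence th theta ->
  argument_function th beta ->
  continuous A ->
  has_sup (range (fun t => opnorm (A t))) ->
  mu = sup (range (fun t => opnorm (A t))) ->
  (forall y w, continuous (fun t => f t y w)) ->
  (forall t, f t 0 0 = 0) ->
  0 <= l ->
  (forall t y1 y2 w1 w2,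
     enorm (f t y1 w1 - f t y2 w2) <= l * (enorm (y1 - y2) + enorm (w1 - w2))) ->
  exp_dichotomy A X P K sigma ->
  \rank P = k ->
  l * M * theta * (1 + M * (1 + l * theta) * expR (M * l * theta)) < m ->
  lyapunov_matrix Q ->
  block_diagonalizes A X P Q Bp Bm ->
  transition_matrix Bp U ->
  transition_matrix Bm V ->
  (forall t s, s <= t -> opnorm (U t s) <= K * expR (- sigma * (t - s))) ->
  (forall t s, t <= s -> opnorm (V t s) <= K * expR (- sigma * (s - t))) ->
  0 <= L -> L <= L0 ->
  (forall t z1 z2 w1 w2,
     enorm (gp t z1 w1 - gp t z2 w2) + enorm (gm t z1 w1 - gm t z2 w2)
     <= L * (enorm (z1 - z2) + enorm (w1 - w2))) ->
  stable_manifold_function th beta rhs K sigma theta eps alpha L F ->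
  integral_set th beta rhs (graph_surface F).
Proof.
(* The threshold at which the contraction factor [4 K L / sigma] equals [1/2]. *)
exists (sigma / (8 * K)); split; first by rewrite divr_gt0 ?mulr_gt0.
move=> k p th beta A mu f l X P Q Bp Bm U V L F M m gp gm rhs sw ba _ A_sup mu_sup
  _ _ l_ge0 f_lip _ _ l_small [Q_diff _ Q_unit [C QC]] [Q_block _] UB VB U_decay
  V_decay L_ge0 L_small g_lip [_ _ F_lip F_stable].
have A_le t : opnorm (A t) <= mu.
  by rewrite mu_sup; apply: ub_le_sup; [case: A_sup|exists t].
have mu_ge0 : 0 <= mu by apply: le_trans (A_le 0); exact: opnorm_ge0.
have C_ge0 : 0 <= C by have [h _ _] := QC 0; apply: le_trans h; exact: opnorm_ge0.
have bound q n (N : 'M[R]_(q, n)) a x : opnorm N <= a -> enorm (N *m x) <= a * enorm x.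
  move=> Na; apply: le_trans (enorm_mulmx _ _) _.
  by rewrite ler_wpM2r// enorm_ge0.
(* [C] may be 0, for instance in dimension 0; a strictly positive bound is wanted. *)
have QC1 t : [/\ opnorm (Q t) <= C + 1, opnorm (derive1 Q t) <= C + 1 &
    opnorm (invmx (Q t)) <= C + 1].
  by have [h1 h2 h3] := QC t; split; rewrite ler_wpDr.
apply: (@stable_graph_integral _ _ _ _ theta _ A mu _ l _ _ _ (C + 1) L sw ba theta_gt0
  mu_ge0 l_ge0 _ f_lip l_small Q_diff Q_unit _ _ _ _ Q_block L_ge0 g_lip K sigma U V
  K_gt0 sigma_gt0 UB VB _ _ L_small F _ _ F_lip).
- by move=> t x; exact: bound.
- by rewrite ltr_wpDl.
- by move=> t x; apply: bound; have [] := QC1 t.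
- by move=> t x; apply: bound; have [] := QC1 t.
- by move=> t x; apply: bound; have [] := QC1 t.
- by move=> t s x st; apply: bound; exact: U_decay.
- by move=> t s x ts; apply: bound; exact: V_decay.
- rewrite divr_ge0 ?addr_ge0 ?(ltW sigma_gt0) ?(ltW alpha_gt0)//.
  by rewrite !mulr_ge0 ?addr_ge0 ?expR_ge0 ?exprn_ge0 ?(ltW K_gt0).
(* Exponential decay is turned into boundedness, the exponential being at most 1 to the right of
   [t0]. *)
- move=> t0 u0; have [z [zs zt0 z_decay]] := F_stable t0 u0.
  exists z; split => //; exists ((K + eps) * enorm u0) => t t0t.
  apply: le_trans (z_decay t t0t) _; rewrite ler_piMr//.
    by rewrite mulr_ge0 ?enorm_ge0// addr_ge0// ltW.
  by rewrite -expR0 ler_expR mulNr oppr_le0 mulr_ge0 ?subr_ge0// ltW.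
Qed.
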